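(* Let $(X,L)$ be a measurable bundle of $C^*$-algebras over $\Omega$ (with the standing assumptions in the context) and let $T:L_0(\Omega,X)\to L_0(\Omega,X)$ be a Markov operator. Then there exists a measurable bundle of Markov operators $\{T_\omega:X(\omega)\to X(\omega):\omega\in\Omega\}$ such that for every $x\in L_0(\Omega,X)$ $$(Tx)(\omega)=T_\omega x(\omega)\quad\text{for almost all }\omega\in\Omega.$$
   Context: $(\Omega,\Sigma,\lambda)$ is a measure space with finite complete measure $\lambda$; $L_0=L_0(\Omega)$ is the algebra of a.e.-equivalence classes of measurable complex functions, with the a.e. order on real elements and unit $\mathbf 1$. $\mathcal L^\infty(\Omega)$ is the set of bounded measurable functions on $\Omega$ (defined everywhere, sup norm), and $L^\infty(\Omega)=\{f\in L_0:|f|\le\alpha\mathbf 1\text{ for some }\alpha>0\}$ with the usual norm. Measurable bundle of $C^*$-algebras: $X$ assigns to each $\omega\in\Omega$ a $C^*$-algebra $X(\omega)\ne\{0\}$. A section is a function $u$ defined a.e. on $\Omega$ with $u(\omega)\in X(\omega)$ for $\omega\in\mathrm{dom}(u)$. $(X,L)$, with $L$ a set of sections, is a measurable bundle of $C^*$-algebras if: $L$ is closed under complex linear combinations, products and involution (all defined pointwise on the intersections of the domains); for each $c\in L$ the function $\omega\mapsto\|c(\omega)\|_{X(\omega)}$ is measurable; and for every $\omega\in\Omega$ the set $\{c(\omega):c\in L,\ \omega\in\mathrm{dom}(c)\}$ is dense in $X(\omega)$. A section $s$ is simple if $s(\omega)=\sum_{i=1}^n\chi_{A_i}(\omega)c_i(\omega)$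 for a.e. $\omega$, with $c_i\in L$, $A_i\in\Sigma$. A section $u$ is measurable if there are simple sections $s_n$ with $s_n(\omega)\to u(\omega)$ for a.e. $\omega$. $M(\Omega,X)$ is the set of measurable sections; $L_0(\Omega,X)$ is its quotient by a.e. equality; $\widehat u$ is the class of $u$; $\|\widehat u\|\in L_0$ is the class of $\omega\mapsto\|u(\omega)\|_{X(\omega)}$. With pointwise operations $L_0(\Omega,X)$ is a $*$-algebra and an $L_0$-module. $L^\infty(\Omega,X)=\{\widehat u\in L_0(\Omega,X):\|\widehat u\|\in L^\infty(\Omega)\}$, and $\mathcal L^\infty(\Omega,X)=\{u\in M(\Omega,X):\|u(\cdot)\|_{X(\cdot)}\in\mathcal L^\infty(\Omega)\}$. For $x\in L_0(\Omega,X)$, $x(\omega)$ denotes the value at $\omega$ of any representative. Lifting: $p:L^\infty(\Omega)\to\mathcal L^\infty(\Omega)$ is a (unital) algebra homomorphism with $p(f)\in f$, $\mathrm{dom}\,p(f)=\Omega$ and $\|p(f)\|_{\mathcal L^\infty(\Omega)}=\|f\|_{L^\infty(\Omega)}$. A vector-valued lifting associated with $p$ is a map $\ell:L^\infty(\Omega,X)\to\mathcal L^\infty(\Omega,X)$ such that $\ell(u)\in u$, $\mathrm{dom}\,\ell(u)=\Omega$, $\|\ell(u)(\omega)\|_{X(\omega)}=p(\|u\|)(\omega)$, $\ell(u+v)=\ell(u)+\ell(v)$, $\ell(fu)=p(f)\ell(u)$ for $f\in L^\infty(\Omega)$, $\ell(u^* )=\ell(u)^*$, $\ell(uv)=\ell(u)\ell(v)$,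 and $\{\ell(u)(\omega):u\in L^\infty(\Omega,X)\}$ is dense in $X(\omega)$ for every $\omega$. Standing assumptions: $(X,L)$ admits a vector-valued lifting $\ell$ (associated with a lifting $p$), and $L_0(\Omega,X)$ has a unit $e$ with $\|e\|=\mathbf 1$; $e(\omega):=\ell(e)(\omega)$ is then the unit of $X(\omega)$. A Markov operator on a unital $C^*$-algebra is a positive linear operator from the algebra to itself sending the unit to the unit. An element $x\in L_0(\Omega,X)$ is positive, $x\ge0$, if $x=yy^*$ for some $y\in L_0(\Omega,X)$. A Markov operator on $L_0(\Omega,X)$ is an $L_0$-linear operator $T:L_0(\Omega,X)\to L_0(\Omega,X)$ which is positive ($Tx\ge0$ whenever $x\ge0$) and satisfies $Te=e$. A family of linear operators $\{T_\omega:X(\omega)\to X(\omega):\omega\in\Omega\}$ is a measurable bundle of operators if the section $\omega\mapsto T_\omega u(\omega)$ belongs to $M(\Omega,X)$ for every $u\in M(\Omega,X)$; it is a measurable bundle of Markov operators if moreover $T_\omega$ is a Markov operator on $X(\omega)$ for almost all $\omega$. *)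

(* Defs.v *)
From HB Require Import structures.
From mathcomp Require Import all_boot all_order all_algebra.
From mathcomp Require Import generic_quotient.
From mathcomp Require Import complex.
From mathcomp Require Import all_classical all_reals all_analysis.
From mathcomp Require Import measurable_realfun ess_sup_inf.

Set Implicit Arguments.
Unset Strict Implicit.
Unset Printing Implicit Defensive.

Import Order.TTheory GRing.Theory Num.Theory.
Import numFieldNormedType.Exports.
Local Open Scope classical_set_scope.
Local Open Scope complex_scope.
Local Open Scope ring_scope.
Local Open Scope quotient_scope.

(* Not necessarily unital.  The norm takes its (real) values in [R[i]]. *)
HB.mixin Record CompleteNormedModule_isCstarAlgebra (R : realType) A
    & CompleteNormedModule R[i] A := {
  cmul : A -> A -> A;
  cstar : A -> A;
  cmulA : associative cmul;
  cmulDl : left_distributive cmul +%R;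
  cmulDr : right_distributive cmul +%R;
  cmulZl : forall (k : R[i]) (a b : A), cmul (k *: a) b = k *: cmul a b;
  cmulZr : forall (k : R[i]) (a b : A), cmul a (k *: b) = k *: cmul a b;
  cstarK : involutive cstar;
  cstarD : {morph cstar : a b / a + b};
  cstarZ : forall (k : R[i]) (a : A), cstar (k *: a) = k^*%R *: cstar a;
  cstarM : forall a b : A, cstar (cmul a b) = cmul (cstar b) (cstar a);
  cnormM : forall a b : A, `|cmul a b| <= `|a| * `|b|;
  cnorm_starM : forall a : A, `|cmul (cstar a) a| = `|a| ^+ 2
}.

#[short(type="cstarAlgType")]
HB.structure Definition CstarAlgebra (R : realType) :=
  {A of CompleteNormedModule R[i] A & CompleteNormedModule_isCstarAlgebra R A}.

Structure completeFiniteMeasure d (Omega : measurableType d) (R : realType) :=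
  CompleteFiniteMeasure {
    cfmeasure :> {finite_measure set Omega -> \bar R};
    cfmeasure_complete : measure_is_complete cfmeasure }.

Section sections.
Context d (Omega : measurableType d) (R : realType).

(* A partially defined section: [u w = None] when [w] is not in the domain.
   Pointwise operations are then defined on the intersection of the domains. *)
Definition psection (X : Omega -> cstarAlgType R) := forall w, option (X w).

Variable X : Omega -> cstarAlgType R.
Implicit Types u v : psection X.

Definition sdom u : set Omega := [set w | u w].

Definition olift2 (A : Type) (f : A -> A -> A) (a b : option A) :=
  obind (fun x => omap (f x) b) a.

Definition sadd u v : psection X := fun w => olift2 +%R (u w) (v w).
Definition smul u v : psection X := fun w => olift2 cmul (u w) (v w).
Definition sstar u : psection X := fun w => omap cstar (u w).
Definition sscale (f : Omega -> R[i]) u : psection X :=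
  fun w => omap (fun a => f w *: a) (u w).

(* The value of a section, extended by [0] off its domain; it is only used on
   the domain, or in statements that hold almost everywhere on it. *)
Definition sval u w : X w := odflt 0 (u w).

End sections.

Section bundles.
Context d (Omega : measurableType d) (R : realType).
Variable mu : completeFiniteMeasure Omega R.

Structure cstarBundle := CstarBundle {
  fiber :> Omega -> cstarAlgType R;
  base : set (psection fiber);
  fiber_neq0 : forall w, exists a : fiber w, a != 0;
  base_ae : forall c, base c -> \forall w \ae mu, c w;
  base_lincomb : forall (a b : R[i]) c c', base c -> base c' ->
    base (sadd (sscale (cst a) c) (sscale (cst b) c'));
  base_mul : forall c c', base c -> base c' -> base (smul c c');
  base_star : forall c, base c -> base (sstar c);
  base_norm : forall c, base c ->
    measurable_fun (sdom c) (fun w => complex.Re `|sval c w|);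
  base_dense : forall w,
    dense [set a : fiber w | exists2 c, base c & c w = Some a] }.
Arguments base : clear implicits.

Variable X : cstarBundle.

Definition simple_section (s : psection X) :=
  exists n (c : 'I_n -> psection X) (A : 'I_n -> set Omega),
    [/\ forall i, base X (c i), forall i, measurable (A i) &
      \forall w \ae mu,
        s w = Some (\sum_(i < n) (\1_(A i) w : R[i]) *: sval (c i) w)].

Definition measurable_section (u : psection X) :=
  exists2 s : nat -> psection X, forall n, simple_section (s n) &
    \forall w \ae mu, u w /\ sval (s n) w @[n --> \oo] --> sval u w.

(* M(Omega, X) *)
Record msection := MSection {
  msection_fun :> psection X;
  msectionP : measurable_section msection_fun }.

End bundles.
Arguments base {d Omega R mu} _ _.

Section cstar_theory.
Context (R : realType) (A : cstarAlgType R).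
Implicit Types a b : A.

Lemma cmul0r b : cmul 0 b = 0 :> A.
Proof. by have := cmulZl 0 (0 : A) b; rewrite !scale0r. Qed.

Lemma cmulr0 a : cmul a 0 = 0 :> A.
Proof. by have := cmulZr 0 a (0 : A); rewrite !scale0r. Qed.

Lemma cstar0 : cstar 0 = 0 :> A.
Proof. by have := cstarZ 0 (0 : A); rewrite conjC0 !scale0r. Qed.

Lemma cmulNr a b : cmul (- a) b = - cmul a b.
Proof. by rewrite -scaleN1r cmulZl scaleN1r. Qed.

Lemma cmulrN a b : cmul a (- b) = - cmul a b.
Proof. by rewrite -scaleN1r cmulZr scaleN1r. Qed.

Lemma cstarN a : cstar (- a) = - cstar a.
Proof. by rewrite -scaleN1r cstarZ rmorphN1 scaleN1r. Qed.

Lemma cnorm_star a : `|cstar a| = `|a|.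
Proof.
suff H b : `|cstar b| >= `|b|.
  by apply/eqP; rewrite eq_le H andbT -{2}(cstarK a) H.
have [->|b0] := eqVneq b 0; first by rewrite cstar0.
have nb0 : 0 < `|b| by rewrite normr_gt0.
by rewrite -(ler_pM2r nb0) -expr2 -cnorm_starM cnormM.
Qed.

Lemma cmul_suml (I : Type) (r : seq I) (F : I -> A) b :
  cmul (\sum_(i <- r) F i) b = \sum_(i <- r) cmul (F i) b.
Proof.
exact: (big_morph (cmul^~ b) (fun x y => cmulDl x y b) (cmul0r b)).
Qed.

Lemma cmul_sumr (I : Type) (r : seq I) (F : I -> A) a :
  cmul a (\sum_(i <- r) F i) = \sum_(i <- r) cmul a (F i).
Proof. exact: (big_morph (cmul a) (cmulDr a) (cmulr0 a)). Qed.

Lemma cstar_sum (I : Type) (r : seq I) (F : I -> A) :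
  cstar (\sum_(i <- r) F i) = \sum_(i <- r) cstar (F i).
Proof. exact: (big_morph cstar cstarD cstar0). Qed.

Lemma cvg_cstar (f : nat -> A) a :
  f n @[n --> \oo] --> a -> cstar (f n) @[n --> \oo] --> cstar a.
Proof.
move=> /cvgrPdist_lt fa; apply/cvgrPdist_lt => e e0.
by apply: filterS (fa e e0) => n; rewrite -cstarN -cstarD cnorm_star.
Qed.

Lemma cvg_cmul (f g : nat -> A) a b :
  f n @[n --> \oo] --> a -> g n @[n --> \oo] --> b ->
  cmul (f n) (g n) @[n --> \oo] --> cmul a b.
Proof.
move=> /cvgrPdist_lt fa /cvgrPdist_lt gb; apply/cvgrPdist_lt => e e0.
have a1 : 0 < 1 + `|a| by rewrite ltr_pwDl.
have b1 : 0 < 1 + `|b| by rewrite ltr_pwDl.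
have ea0 : 0 < e / 2 / (1 + `|a|) by rewrite !divr_gt0.
have eb0 : 0 < e / 2 / (1 + `|b|) by rewrite !divr_gt0.
near=> n.
have -> : cmul a b - cmul (f n) (g n) = cmul a (b - g n) + cmul (a - f n) (g n).
  by rewrite cmulDr cmulDl cmulrN cmulNr addrA subrK.
rewrite (le_lt_trans (ler_normD _ _))// [ltRHS](splitr e) ltrD//.
  apply: (le_lt_trans (cnormM _ _)).
  have [->|a0] := eqVneq a 0; first by rewrite normr0 mul0r divr_gt0.
  have : `|b - g n| < e / 2 / (1 + `|a|) by near: n; exact: gb.
  rewrite ltr_pdivlMr// mulrDr mulr1 mulrC => /(le_lt_trans _); apply.
  by rewrite lerDr.
apply: (le_lt_trans (cnormM _ _)).
have gn1 : `|g n| <= 1 + `|b|.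
  rewrite -[g n](subKr b) (le_trans (ler_normB _ _))// addrC lerD2r ltW//.
  by near: n; exact: gb.
apply: (@le_lt_trans _ _ (`|a - f n| * (1 + `|b|))); first by rewrite ler_wpM2l.
by rewrite -ltr_pdivlMr//; near: n; exact: fa.
Unshelve. all: by end_near. Qed.

End cstar_theory.

Section section_theory.
Context d (Omega : measurableType d) (R : realType).
Variable X : Omega -> cstarAlgType R.
Implicit Types u v : psection X.

Lemma sval_mul u v w : sval (smul u v) w = cmul (sval u w) (sval v w).
Proof.
by rewrite /sval /smul; case: (u w) (v w) => [a|] [b|] //=;
  rewrite ?cmul0r ?cmulr0.
Qed.

Lemma sval_star u w : sval (sstar u) w = cstar (sval u w).
Proof. by rewrite /sval /sstar; case: (u w) => //=; rewrite cstar0. Qed.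

Lemma sval_scale f u w : sval (sscale f u) w = f w *: sval u w.
Proof. by rewrite /sval /sscale; case: (u w) => //=; rewrite scaler0. Qed.

Lemma sval_add u v w : u w -> v w -> sval (sadd u v) w = sval u w + sval v w.
Proof. by rewrite /sval /sadd; case: (u w) (v w) => [a|] [b|]. Qed.

Lemma svalE u w : u w -> u w = Some (sval u w).
Proof. by rewrite /sval; case: (u w). Qed.

Lemma sdom_add u v : sdom (sadd u v) = sdom u `&` sdom v.
Proof.
apply/funext => w; rewrite /sdom /sadd/= /setI/=.
by case: (u w) (v w) => [a|] [b|]; apply/propext => //=; split=> // -[].
Qed.

Lemma sdom_mul u v : sdom (smul u v) = sdom u `&` sdom v.
Proof.
apply/funext => w; rewrite /sdom /smul/= /setI/=.
by case: (u w) (v w) => [a|] [b|]; apply/propext => //=; split=> // -[].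
Qed.

Lemma sdom_star u : sdom (sstar u) = sdom u.
Proof. by apply/funext => w; rewrite /sdom /sstar/=; case: (u w). Qed.

Lemma sdom_scale f u : sdom (sscale f u) = sdom u.
Proof. by apply/funext => w; rewrite /sdom /sscale/=; case: (u w). Qed.

End section_theory.

Section simple_theory.
Context d (Omega : measurableType d) (R : realType).
Variable mu : completeFiniteMeasure Omega R.
Variable X : cstarBundle mu.
Implicit Types s t : psection X.

Lemma base_scale (k : R[i]) c : base X c -> base X (sscale (cst k) c).
Proof.
move=> Lc; suff -> : sscale (cst k) c =
    sadd (sscale (cst k) c) (sscale (cst 0) c) by exact: base_lincomb.
apply: functional_extensionality_dep => w; rewrite /sadd /sscale.
by case: (c w) => //= a; rewrite scale0r addr0.
Qed.

Lemma base_add c c' : base X c -> base X c' -> base X (sadd c c').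
Proof.
move=> Lc Lc'; have := base_lincomb 1 1 Lc Lc'; congr (base X _).
apply: functional_extensionality_dep => w; rewrite /sadd /sscale.
by case: (c w) (c' w) => [a|] [b|] //=; rewrite !scale1r.
Qed.

Lemma simple_ae s : simple_section s -> \forall w \ae mu, s w.
Proof.
by move=> [n [c [A [_ _]]]]; apply: filterS => w ->.
Qed.

Lemma simple_fin (I : finType) (c : I -> psection X) (A : I -> set Omega) s :
    (forall i, base X (c i)) -> (forall i, measurable (A i)) ->
    (\forall w \ae mu,
       s w = Some (\sum_i (\1_(A i) w : R[i]) *: sval (c i) w)) ->
  simple_section s.
Proof.
move=> Lc mA sE; exists #|I|, (c \o enum_val), (A \o enum_val); split=> //.
- by move=> i; exact: Lc.
- by move=> i; exact: mA.
- apply: filterS sE => w ->; congr Some.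
  exact: (big_enum_val (fun i => (\1_(A i) w : R[i]) *: sval (c i) w)).
Qed.

Lemma simple_aeq s t : (\forall w \ae mu, s w = t w) ->
  simple_section s -> simple_section t.
Proof.
move=> st [n [c [A [Lc mA sE]]]]; exists n, c, A; split=> //.
by apply: filterS2 st sE => w <-.
Qed.

Lemma simple0 : simple_section (fun w => Some (0 : X w)).
Proof.
exists 0%N, (fun i w => None), (fun=> set0); split; try by case.
by apply: aeW => w; rewrite big_ord0.
Qed.

Lemma simple_add s t :
  simple_section s -> simple_section t -> simple_section (sadd s t).
Proof.
move=> [n [c [A [Lc mA sE]]]] [m [c' [B [Lc' mB tE]]]].
pose C (k : 'I_n + 'I_m) := match k with inl i => c i | inr j => c' j end.
pose D (k : 'I_n + 'I_m) := match k with inl i => A i | inr j => B j end.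
apply: (@simple_fin _ C D); [by case|by case|].
by apply: filterS2 sE tE => w sE tE; rewrite /sadd sE tE/= big_sumType/=.
Qed.

Lemma simple_mul s t :
  simple_section s -> simple_section t -> simple_section (smul s t).
Proof.
move=> [n [c [A [Lc mA sE]]]] [m [c' [B [Lc' mB tE]]]].
pose C (k : 'I_n * 'I_m) := smul (c k.1) (c' k.2).
pose D (k : 'I_n * 'I_m) := A k.1 `&` B k.2.
apply: (@simple_fin _ C D).
- by move=> k; exact: base_mul.
- by move=> k; exact: measurableI.
- apply: filterS2 sE tE => w sE tE; rewrite /smul sE tE/=; congr Some.
  transitivity (\sum_i \sum_j cmul ((\1_(A i) w : R[i]) *: sval (c i) w)
      ((\1_(B j) w : R[i]) *: sval (c' j) w)).
    by rewrite cmul_suml; apply: eq_bigr => i _; rewrite cmul_sumr.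
  rewrite pair_bigA; apply: eq_bigr => -[i j] _ /=.
  by rewrite sval_mul indicI cmulZl cmulZr scalerA.
Qed.

Lemma simple_star s : simple_section s -> simple_section (sstar s).
Proof.
move=> [n [c [A [Lc mA sE]]]].
exists n, (fun i => sstar (c i)), A; split=> // [i|]; first exact: base_star.
apply: filterS sE => w sE; rewrite /sstar sE/=; congr Some.
rewrite cstar_sum; apply: eq_bigr => i _; rewrite cstarZ sval_star.
by congr (_ *: _); rewrite indicE; exact: rmorph_nat.
Qed.

Lemma simple_scale_indic (k : R[i]) B s : measurable B ->
  simple_section s -> simple_section (sscale (fun w => k * \1_B w) s).
Proof.
move=> mB [n [c [A [Lc mA sE]]]].
exists n, (fun i => sscale (cst k) (c i)), (fun i => A i `&` B).
split=> [i|i|]; [exact: base_scale|exact: measurableI|].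
apply: filterS sE => w sE; rewrite /sscale sE/=; congr Some.
rewrite scaler_sumr; apply: eq_bigr => i _; rewrite -/(sscale (cst k) (c i)).
by rewrite sval_scale !scalerA indicI/= mulrC mulrA mulrAC.
Qed.

Lemma simple_scale_sfun (k : R[i]) (g : {fimfun Omega >-> R}) s :
  (forall y, measurable (g @^-1` [set y])) ->
  simple_section s -> simple_section (sscale (fun w => k * (g w)%:C) s).
Proof.
move=> mg ss.
have [r rE] : exists r : seq R, forall w,
    g w = \sum_(y <- r) y * \1_(g @^-1` [set y]) w.
  exists (finmap.enum_fset (fset_set (range g))) => w.
  by rewrite {1}fimfunE fsbig_finite.
have {rE} -> : (fun w => k * (g w)%:C) =
    (fun w => \sum_(y <- r) (k * y%:C) * \1_(g @^-1` [set y]) w).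
  apply/funext => w; rewrite {1}rE rmorph_sum mulr_sumr; apply: eq_bigr => y _.
  by rewrite rmorphM mulrA; congr (_ * _); rewrite !indicE; exact: rmorph_nat.
elim: r => [|y r IH].
  apply: simple_aeq simple0; apply: filterS (simple_ae ss) => w /svalE sE.
  by rewrite /sscale sE/= big_nil scale0r.
apply: simple_aeq (simple_add (simple_scale_indic (k * y%:C) (mg y) ss) IH).
apply: filterS (simple_ae ss) => w /svalE sE.
by rewrite /sadd /sscale sE/= big_cons scalerDl.
Qed.

End simple_theory.

Import HBSimple.

Definition cmeasurable d (Omega : measurableType d) (R : realType)
    (f : Omega -> R[i]) :=
  measurable_fun setT (fun w => complex.Re (f w)) /\
  measurable_fun setT (fun w => complex.Im (f w)).

Section measurable_section_theory.
Context d (Omega : measurableType d) (R : realType).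
Variable mu : completeFiniteMeasure Omega R.
Variable X : cstarBundle mu.
Implicit Types s t u v : psection X.

Lemma msection_ae u : measurable_section u -> \forall w \ae mu, u w.
Proof. by move=> [s _]; apply: filterS => w []. Qed.

Lemma simple_ae_all (s : nat -> psection X) :
  (forall n, simple_section (s n)) -> \forall w \ae mu, forall n, s n w.
Proof.
move=> ss; apply: (@negligibleS _ _ _ mu (\bigcup_n ~` [set w | s n w])).
  by move=> w /= /existsNP[n sn]; exists n.
by apply: negligible_bigcup => n; exact: simple_ae.
Qed.

Lemma measurable_sadd u v : measurable_section u -> measurable_section v ->
  measurable_section (sadd u v).
Proof.
move=> [s ss su] [t st tv]; exists (fun n => sadd (s n) (t n)).
  by move=> n; exact: simple_add.
apply: filterS2 (filterI su tv) (filterI (simple_ae_all ss) (simple_ae_all st)).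
move=> w [[uw suw] [vw tvw]] [sw tw]; split.
  by rewrite /sadd (svalE uw) (svalE vw).
rewrite sval_add//.
have -> : (fun n => sval (sadd (s n) (t n)) w) =
    (fun n => sval (s n) w) + (fun n => sval (t n) w).
  by apply/funext => n; rewrite sval_add.
exact: cvgD.
Qed.

Lemma measurable_smul u v : measurable_section u -> measurable_section v ->
  measurable_section (smul u v).
Proof.
move=> [s ss su] [t st tv]; exists (fun n => smul (s n) (t n)).
  by move=> n; exact: simple_mul.
apply: filterS2 su tv => w [uw suw] [vw tvw]; split.
  by rewrite /smul (svalE uw) (svalE vw).
rewrite sval_mul.
have -> : (fun n => sval (smul (s n) (t n)) w) =
    (fun n => cmul (sval (s n) w) (sval (t n) w)).
  by apply/funext => n; rewrite sval_mul.
exact: cvg_cmul.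
Qed.

Lemma measurable_sstar u : measurable_section u -> measurable_section (sstar u).
Proof.
move=> [s ss su]; exists (fun n => sstar (s n)).
  by move=> n; exact: simple_star.
apply: filterS su => w [uw suw]; split; first by rewrite /sstar (svalE uw).
rewrite sval_star.
have -> : (fun n => sval (sstar (s n)) w) = (fun n => cstar (sval (s n) w)).
  by apply/funext => n; rewrite sval_star.
exact: cvg_cstar.
Qed.

Lemma normC_real (x : R) : `|x%:C| = `|x|%:C.
Proof. by rewrite normc_def/= expr0n addr0 sqrtr_sqr. Qed.

Let C : numFieldType := R[i].

Let cvgC_lt (f : nat -> C) (a : C) : f n @[n --> \oo] --> a <->
  (forall e : C, 0 < e -> \forall n \near \oo, `|a - f n| < e).
Proof. exact: cvgrPdist_lt. Qed.

Lemma cvg_realC (f : nat -> R) (a : R) :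
  f n @[n --> \oo] --> a -> (f n)%:C @[n --> \oo] --> (a%:C : C).
Proof.
move=> /cvgrPdist_lt fa; apply/cvgC_lt => -[e e'] /=.
rewrite ltcE/= => /andP[/eqP -> e0]; move: (fa e e0); apply: filterS => n ane.
by rewrite -rmorphB/= normC_real ltcR.
Qed.

Lemma cvg_Re (f : nat -> C) (a : C) :
  f n @[n --> \oo] --> a -> complex.Re (f n) @[n --> \oo] --> complex.Re a.
Proof.
move=> /cvgC_lt fa; apply/cvgrPdist_lt => e e0.
have e0' : 0 < e%:C by rewrite ltcR.
apply: filterS (fa _ e0') => n ane; rewrite -ltcR.
by rewrite (le_lt_trans _ ane)// -raddfB normc_ge_Re.
Qed.

Lemma measurable_sscale (f : Omega -> R[i]) u : cmeasurable f ->
  measurable_section u -> measurable_section (sscale f u).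
Proof.
move=> [mRe mIm] [s ss su].
have approx (h : Omega -> R) : measurable_fun setT h ->
    exists2 g : nat -> {fimfun Omega >-> R},
      (forall n y, measurable (g n @^-1` [set y])) &
      forall w, g n w @[n --> \oo] --> h w.
  move=> mh; have mEh : measurable_fun setT (EFin \o h).
    exact/measurable_EFinP.
  have [g gh] := approximation_sfun measurableT mEh.
  exists (fun n => g n) => [n y|w]; first exact: (measurable_funPTI (g n) (measurable_set1 y)).
  by have /fine_cvgP[_] := gh w Logic.I.
have [g mg gf] := approx _ mRe; have [h mh hf] := approx _ mIm.
exists (fun n => sadd (sscale (fun w => 1 * (g n w)%:C) (s n))
                      (sscale (fun w => 'i%C * (h n w)%:C) (s n))).
  by move=> n; apply: simple_add; exact: simple_scale_sfun.
apply: filterS2 su (simple_ae_all ss) => w [uw suw] sw; split.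
  by rewrite /sscale (svalE uw).
rewrite sval_scale.
have -> : (fun n => sval (sadd (sscale (fun w => 1 * (g n w)%:C) (s n))
                      (sscale (fun w => 'i%C * (h n w)%:C) (s n))) w) =
    (fun n => ((g n w)%:C + 'i%C * (h n w)%:C) *: sval (s n) w).
  apply/funext => n; rewrite sval_add ?sval_scale ?mul1r ?scalerDl//;
  by rewrite /sscale (svalE (sw n)).
apply: cvgZ => //; rewrite [f w]complexE; apply: cvgD; first exact: cvg_realC.
by apply: cvgM; [exact: cvg_cst|exact: cvg_realC].
Qed.

Lemma ae_measurable_real (f g : Omega -> R) :
  (\forall w \ae mu, f w = g w) ->
  measurable_fun setT f -> measurable_fun setT g.
Proof.
move=> fg /measurable_EFinP mf; apply/measurable_EFinP.
apply: (ae_measurable_fun (@cfmeasure_complete _ _ _ mu) _ mf).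
by apply: filterS fg => w /= ->.
Qed.

Lemma measurable_base_norm c : base X c ->
  measurable_fun setT (fun w => complex.Re `|sval c w|).
Proof.
move=> Lc; have mc := base_norm Lc.
have mdom : measurable (sdom c).
  rewrite -[sdom c]setCK; apply: measurableC.
  exact: (@cfmeasure_complete _ _ _ mu _ (base_ae Lc)).
have -> : (fun w => complex.Re `|sval c w|) =
    (fun w => complex.Re `|sval c w|) \_ (sdom c).
  apply/funext => w; rewrite patchE; case: ifPn => //.
  rewrite notin_setE /sdom/= /sval; case: (c w) => //= _.
  by rewrite normr0.
exact/(measurable_restrictT _ mdom).
Qed.

Lemma measurable_simple_norm s : simple_section s ->
  measurable_fun setT (fun w => complex.Re `|sval s w|).
Proof.
move=> [n [c [A [Lc mA sE]]]].
suff : measurable_fun setT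
    (fun w => complex.Re `|\sum_(i < n) (\1_(A i) w : R[i]) *: sval (c i) w|).
  apply: ae_measurable_real.
  by apply: filterS sE => w sE; rewrite {2}/sval sE.
case: n c A Lc mA {sE} => [|n] c A Lc mA.
  under eq_fun do rewrite big_ord0 normr0.
  exact: measurable_cst.
suff H m (b : 'I_m -> psection X) (B : 'I_m -> set Omega) e :
    (forall i, base X (b i)) -> (forall i, measurable (B i)) -> base X e ->
    measurable_fun setT (fun w => complex.Re
      `|sval e w + \sum_(i < m) (\1_(B i) w : R[i]) *: sval (b i) w|).
  have := H _ _ _ _ Lc mA (base_scale 0 (Lc ord0)).
  by under eq_fun do rewrite sval_scale scale0r add0r.
elim: m b B e => [|m IH] b B e Lb mB Le.
  under eq_fun do rewrite big_ord0 addr0.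
  exact: measurable_base_norm.
have IH1 := IH (fun i => b (lift ord0 i)) (fun i => B (lift ord0 i)) _
  (fun i => Lb _) (fun i => mB _).
have -> : (fun w => complex.Re
    `|sval e w + \sum_(i < m.+1) (\1_(B i) w : R[i]) *: sval (b i) w|) =
  (fun w => if w \in B ord0 then complex.Re `|(sval e w + sval (b ord0) w) +
       \sum_(i < m) (\1_(B (lift ord0 i)) w : R[i]) *: sval (b (lift ord0 i)) w|
     else complex.Re `|sval e w +
       \sum_(i < m) (\1_(B (lift ord0 i)) w : R[i]) *: sval (b (lift ord0 i)) w|).
  apply/funext => w; rewrite big_ord_recl indicE.
  by case: ifP => _; rewrite ?scale1r ?scale0r ?add0r ?addrA.
apply: measurable_fun_ifT; last exact: IH1.
  apply: (measurable_fun_bool true); rewrite setTI.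
  rewrite (_ : _ @^-1` _ = B ord0)//.
  by apply/seteqP; split=> w /=; [exact: set_mem|exact: mem_set].
apply: ae_measurable_real (IH1 _ (base_add Le (Lb ord0))).
apply: filterS2 (base_ae Le) (base_ae (Lb ord0)) => w ew bw.
by rewrite sval_add.
Qed.

Lemma measurable_section_norm u : measurable_section u ->
  cmeasurable (fun w => `|sval u w|).
Proof.
move=> [s ss su]; split; last first.
  have -> : (fun w => complex.Im `|sval u w|) = cst 0.
    apply/funext => w; have := normr_ge0 (sval u w).
    by rewrite lecE/= => /andP[/eqP ->].
  exact: measurable_cst.
case: su => N [mN N0 sN].
have mh n : measurable_fun setT
    ((fun w => complex.Re `|sval (s n) w|) \_ (~` N)).
  apply/(measurable_restrictT _ (measurableC mN)).
  exact/measurable_funTS/measurable_simple_norm.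
suff : measurable_fun setT ((fun w => complex.Re `|sval u w|) \_ (~` N)).
  apply: ae_measurable_real; exists N; split=> // w /= Hw.
  by apply: contrapT => Nw; apply: Hw; rewrite patchE mem_set.
apply: (measurable_fun_cvg mh) => w _.
rewrite /patch; case: ifPn => [|_]; last exact: cvg_cst.
rewrite inE => Nw; apply: cvg_Re; apply: cvg_norm.
suff [] : u w /\ sval (s n) w @[n --> \oo] --> sval u w by [].
by apply: contrapT => H; exact/Nw/sN.
Qed.

End measurable_section_theory.

Section scalars.
Context d (Omega : measurableType d) (R : realType).
Implicit Types f g : Omega -> R[i].

Lemma cmeasurable_cst (k : R[i]) : cmeasurable (fun _ : Omega => k).
Proof. by split; exact: measurable_cst. Qed.

Lemma cmeasurable_add f g : cmeasurable f -> cmeasurable g ->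
  cmeasurable (fun w => f w + g w).
Proof.
move=> [fr fi] [gr gi]; split.
  by under eq_fun do rewrite raddfD/=; exact: measurable_funD.
by under eq_fun do rewrite raddfD/=; exact: measurable_funD.
Qed.

Lemma cmeasurable_mul f g : cmeasurable f -> cmeasurable g ->
  cmeasurable (fun w => f w * g w).
Proof.
move=> [fr fi] [gr gi]; split.
  have -> : (fun w => complex.Re (f w * g w)) = (fun w =>
      complex.Re (f w) * complex.Re (g w) - complex.Im (f w) * complex.Im (g w)).
    by apply/funext => w; case: (f w) (g w) => [a b] [].
  by apply: measurable_funB; exact: measurable_funM.
have -> : (fun w => complex.Im (f w * g w)) = (fun w =>
    complex.Re (f w) * complex.Im (g w) + complex.Im (f w) * complex.Re (g w)).
  by apply/funext => w; case: (f w) (g w) => [a b] [].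
by apply: measurable_funD; exact: measurable_funM.
Qed.

Record cmfun := CMFun {
  cmfun_fun :> Omega -> R[i];
  cmfunP : cmeasurable cmfun_fun }.

HB.instance Definition _ := gen_eqMixin cmfun.
HB.instance Definition _ := gen_choiceMixin cmfun.

Variable mu : completeFiniteMeasure Omega R.

Definition cmfun_aeeq (f g : cmfun) := `[< \forall w \ae mu, f w = g w >].

Let cmfun_aeeq_refl : reflexive cmfun_aeeq.
Proof. by move=> f; apply/asboolP/aeW. Qed.

Let cmfun_aeeq_sym : symmetric cmfun_aeeq.
Proof.
by move=> f g; apply/asboolP/asboolP; apply: filterS => w ->.
Qed.

Let cmfun_aeeq_trans : transitive cmfun_aeeq.
Proof.
move=> f g h /asboolP gf /asboolP fh; apply/asboolP.
by apply: filterS2 gf fh => w -> ->.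
Qed.

Canonical cmfun_aeeq_equiv :=
  EquivRel cmfun_aeeq cmfun_aeeq_refl cmfun_aeeq_sym cmfun_aeeq_trans.

Definition L0 : Type := {eq_quot cmfun_aeeq}.
HB.instance Definition _ := Choice.on L0.
HB.instance Definition _ := EqQuotient.on L0.

Definition L0class f (mf : cmeasurable f) : L0 := \pi_L0 (CMFun mf).

Definition L0cst (k : R[i]) : L0 := L0class (cmeasurable_cst k).
Definition L0add (f g : L0) : L0 :=
  L0class (cmeasurable_add (cmfunP (repr f)) (cmfunP (repr g))).
Definition L0mul (f g : L0) : L0 :=
  L0class (cmeasurable_mul (cmfunP (repr f)) (cmfunP (repr g))).

(* [g] is a representative of the class [f]. *)
Definition L0mem (f : L0) (g : Omega -> R[i]) :=
  exists mg : cmeasurable g, f = L0class mg.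

Lemma L0memP (f : L0) g : L0mem f g <->
  cmeasurable g /\ \forall w \ae mu, (repr f : cmfun) w = g w.
Proof.
split=> [[mg ->]|[mg fg]].
  split=> //.
  have /eqmodP/asboolP : \pi_L0 (repr (L0class mg)) = \pi_L0 (CMFun mg).
    by rewrite reprK.
  by [].
exists mg; rewrite -[f]reprK; apply/eqmodP/asboolP; exact: fg.
Qed.

Lemma L0mem_repr (f : L0) : L0mem f (repr f : cmfun).
Proof. by apply/L0memP; split; [exact: cmfunP|exact: aeW]. Qed.

Lemma L0mem_class f (mf : cmeasurable f) : L0mem (L0class mf) f.
Proof. by exists mf. Qed.

Lemma L0mem_add (f g : L0) f' g' : L0mem f f' -> L0mem g g' ->
  L0mem (L0add f g) (fun w => f' w + g' w).
Proof.
move=> /L0memP[mf ff'] /L0memP[mg gg']; apply/L0memP.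
split; first exact: cmeasurable_add.
have /L0memP[_] := L0mem_class
  (cmeasurable_add (cmfunP (repr f)) (cmfunP (repr g))).
by apply: filterS3 ff' gg' => w <- <-.
Qed.

Lemma L0mem_mul (f g : L0) f' g' : L0mem f f' -> L0mem g g' ->
  L0mem (L0mul f g) (fun w => f' w * g' w).
Proof.
move=> /L0memP[mf ff'] /L0memP[mg gg']; apply/L0memP.
split; first exact: cmeasurable_mul.
have /L0memP[_] := L0mem_class
  (cmeasurable_mul (cmfunP (repr f)) (cmfunP (repr g))).
by apply: filterS3 ff' gg' => w <- <-.
Qed.

(* L^oo(Omega) as a subset of L_0(Omega) *)
Definition Linf (f : L0) := exists2 a : R, 0 < a &
  \forall w \ae mu, `|(repr f : cmfun) w| <= a%:C.

Definition Linf_norm (f : L0) : \bar R :=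
  Lnorm mu +oo%E (fun w => (complex.Re `|(repr f : cmfun) w|)%:E).

Definition bounded_measurable (g : Omega -> R[i]) :=
  cmeasurable g /\ exists a : R, forall w, `|g w| <= a%:C.

Definition sup_norm (g : Omega -> R[i]) : \bar R :=
  ereal_sup (range (fun w => (complex.Re `|g w|)%:E)).

(* [p] is only constrained on L^oo(Omega). *)
Record is_lifting (p : L0 -> Omega -> R[i]) : Prop := {
  lifting_bounded : forall f : L0, Linf f -> bounded_measurable (p f);
  lifting_mem : forall f : L0, Linf f -> L0mem f (p f);
  lifting_norm : forall f : L0, Linf f -> sup_norm (p f) = Linf_norm f;
  lifting1 : p (L0cst 1) = cst 1;
  liftingD : forall f g : L0, Linf f -> Linf g ->
    p (L0add f g) = (fun w => p f w + p g w);
  liftingM : forall f g : L0, Linf f -> Linf g ->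
    p (L0mul f g) = (fun w => p f w * p g w);
  liftingZ : forall (k : R[i]) (f : L0), Linf f ->
    p (L0mul (L0cst k) f) = (fun w => k * p f w) }.

End scalars.

Section vectors.
Context d (Omega : measurableType d) (R : realType).
Variable mu : completeFiniteMeasure Omega R.

Section quotient.
Variable X : cstarBundle mu.
Implicit Types u v : psection X.

HB.instance Definition _ := gen_eqMixin (msection X).
HB.instance Definition _ := gen_choiceMixin (msection X).

Definition msection_aeeq (u v : msection X) :=
  `[< \forall w \ae mu, msection_fun u w = msection_fun v w >].

Let msection_aeeq_refl : reflexive msection_aeeq.
Proof. by move=> u; apply/asboolP/aeW. Qed.

Let msection_aeeq_sym : symmetric msection_aeeq.
Proof.
by move=> u v; apply/asboolP/asboolP; apply: filterS => w ->.
Qed.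

Let msection_aeeq_trans : transitive msection_aeeq.
Proof.
move=> u v w /asboolP vu /asboolP uw; apply/asboolP.
by apply: filterS2 vu uw => x -> ->.
Qed.

Canonical msection_aeeq_equiv := EquivRel msection_aeeq
  msection_aeeq_refl msection_aeeq_sym msection_aeeq_trans.

(* L_0(Omega, X) *)
Definition Lsec : Type := {eq_quot msection_aeeq}.
HB.instance Definition _ := Choice.on Lsec.
HB.instance Definition _ := EqQuotient.on Lsec.

Definition Lclass u (hu : measurable_section u) : Lsec :=
  \pi_Lsec (MSection hu).

Definition Ladd (x y : Lsec) : Lsec :=
  Lclass (measurable_sadd (msectionP (repr x)) (msectionP (repr y))).
Definition Lmul (x y : Lsec) : Lsec :=
  Lclass (measurable_smul (msectionP (repr x)) (msectionP (repr y))).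
Definition Lstar (x : Lsec) : Lsec :=
  Lclass (measurable_sstar (msectionP (repr x))).
Definition Lscale (f : L0 mu) (x : Lsec) : Lsec :=
  Lclass (measurable_sscale (cmfunP (repr f)) (msectionP (repr x))).
Definition Lvnorm (x : Lsec) : L0 mu :=
  L0class mu (measurable_section_norm (msectionP (repr x))).

(* [u] is a representative of the class [x]. *)
Definition Lmem (x : Lsec) u :=
  exists hu : measurable_section u, x = Lclass hu.

Lemma LmemP x u : Lmem x u <-> measurable_section u /\
  \forall w \ae mu, msection_fun (repr x) w = u w.
Proof.
split=> [[hu ->]|[hu xu]].
  split=> //.
  have /eqmodP/asboolP : \pi_Lsec (repr (Lclass hu)) = \pi_Lsec (MSection hu).
    by rewrite reprK.
  by [].
by exists hu; rewrite -[x]reprK; apply/eqmodP/asboolP; exact: xu.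
Qed.

Lemma Lmem_repr (x : Lsec) : Lmem x (msection_fun (repr x)).
Proof. by apply/LmemP; split; [exact: msectionP|exact: aeW]. Qed.

Lemma Lmem_class u (hu : measurable_section u) : Lmem (Lclass hu) u.
Proof. by exists hu. Qed.

Lemma Lmem_add x y u v : Lmem x u -> Lmem y v -> Lmem (Ladd x y) (sadd u v).
Proof.
move=> /LmemP[hu xu] /LmemP[mv yv]; apply/LmemP.
split; first exact: measurable_sadd.
have /LmemP[_] := Lmem_class
  (measurable_sadd (msectionP (repr x)) (msectionP (repr y))).
by apply: filterS3 xu yv => w; rewrite /sadd => <- <-.
Qed.

Lemma Lmem_mul x y u v : Lmem x u -> Lmem y v -> Lmem (Lmul x y) (smul u v).
Proof.
move=> /LmemP[hu xu] /LmemP[mv yv]; apply/LmemP.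
split; first exact: measurable_smul.
have /LmemP[_] := Lmem_class
  (measurable_smul (msectionP (repr x)) (msectionP (repr y))).
by apply: filterS3 xu yv => w; rewrite /smul => <- <-.
Qed.

Lemma Lmem_star x u : Lmem x u -> Lmem (Lstar x) (sstar u).
Proof.
move=> /LmemP[hu xu]; apply/LmemP; split; first exact: measurable_sstar.
have /LmemP[_] := Lmem_class (measurable_sstar (msectionP (repr x))).
by apply: filterS2 xu => w; rewrite /sstar => <-.
Qed.

Lemma Lmem_scale f x g u : L0mem f g -> Lmem x u ->
  Lmem (Lscale f x) (sscale g u).
Proof.
move=> /L0memP[mg fg] /LmemP[hu xu]; apply/LmemP.
split; first exact: measurable_sscale.
have /LmemP[_] := Lmem_class
  (measurable_sscale (cmfunP (repr f)) (msectionP (repr x))).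
by apply: filterS3 fg xu => w; rewrite /sscale => <- <-.
Qed.

Lemma Lmem_vnorm x u : Lmem x u -> L0mem (Lvnorm x) (fun w => `|sval u w|).
Proof.
move=> /LmemP[hu xu]; apply/L0memP; split; first exact: measurable_section_norm.
have /L0memP[_] := L0mem_class mu (measurable_section_norm (msectionP (repr x))).
by apply: filterS2 xu => w; rewrite /sval => <-.
Qed.

(* L^oo(Omega, X) as a subset of L_0(Omega, X) *)
Definition Linf_sec (x : Lsec) := Linf (Lvnorm x).

Definition Lunit (e : Lsec) := forall x, Lmul e x = x /\ Lmul x e = x.

Definition Lpositive (x : Lsec) := exists y, x = Lmul y (Lstar y).

(* The values of [l] are sections defined on all of [Omega]; [l] is only
   constrained on L^oo(Omega, X). *)
Record is_vector_lifting (p : L0 mu -> Omega -> R[i])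
    (l : Lsec -> forall w, X w) : Prop := {
  vlifting_bounded : forall x, Linf_sec x ->
    bounded_measurable (fun w => `|l x w|);
  vlifting_mem : forall x, Linf_sec x -> Lmem x (fun w => Some (l x w));
  vlifting_norm : forall x, Linf_sec x -> forall w, `|l x w| = p (Lvnorm x) w;
  vliftingD : forall x y, Linf_sec x -> Linf_sec y ->
    forall w, l (Ladd x y) w = l x w + l y w;
  vliftingZ : forall f x, Linf f -> Linf_sec x ->
    forall w, l (Lscale f x) w = p f w *: l x w;
  vlifting_star : forall x, Linf_sec x ->
    forall w, l (Lstar x) w = cstar (l x w);
  vliftingM : forall x y, Linf_sec x -> Linf_sec y ->
    forall w, l (Lmul x y) w = cmul (l x w) (l y w);
  vlifting_dense : forall w,
    dense [set a : X w | exists2 x, Linf_sec x & l x w = a] }.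

Record is_Lmarkov (e : Lsec) (T : Lsec -> Lsec) : Prop := {
  LmarkovD : forall x y, T (Ladd x y) = Ladd (T x) (T y);
  LmarkovZ : forall f x, T (Lscale f x) = Lscale f (T x);
  Lmarkov_pos : forall x, Lpositive x -> Lpositive (T x);
  Lmarkov_unit : T e = e }.

End quotient.

Definition cunit (A : cstarAlgType R) (e : A) :=
  forall a, cmul e a = a /\ cmul a e = a.

Definition cpositive (A : cstarAlgType R) (a : A) :=
  exists b : A, a = cmul b (cstar b).

Definition is_cmarkov (A : cstarAlgType R) (T : {linear A -> A}) :=
  (forall a, cpositive a -> cpositive (T a)) /\
  exists2 e : A, cunit e & T e = e.

Definition measurable_operator_bundle (X : cstarBundle mu)
    (T : forall w, {linear X w -> X w}) :=
  forall u : psection X, measurable_section u ->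
    measurable_section (fun w => omap (T w) (u w)).

Definition measurable_markov_bundle (X : cstarBundle mu)
    (T : forall w, {linear X w -> X w}) :=
  measurable_operator_bundle T /\ \forall w \ae mu, is_cmarkov (T w).

End vectors.

(* Main.v *)
(* On L^oo(Omega, X) the operator [T] is bounded: if [x] is self-adjoint with
   [|x| <= 1/2], then [e - x] and [e + x] are squares, their square roots being
   limits of polynomials in [x], so [e - T x] and [e + T x] are positive and
   [|T x| <= 3].  Multiplying [x] by the indicator of a set of the form
   [|x| < r] turns this into the pointwise bound
   [|l (T x) w| <= 12 * |l x w|]; hence [l x w |-> l (T x) w] is well defined
   and bounded on a dense subspace of [X w], and [T_w] is its continuous
   extension.  Its positivity rests on the closedness of the positive cone of a
   C*-algebra, that is, on the fact that each [b b^*] is the square of a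
   self-adjoint element.  For general [x] in L_0(Omega, X) the identity
   [(T x)(w) = T_w (x(w))] follows by rescaling [x] by [1 / (1 + |x|)]. *)

Require Import Defs.
From HB Require Import structures.
From mathcomp Require Import all_boot all_order all_algebra.
From mathcomp Require Import generic_quotient.
From mathcomp Require Import complex.
From mathcomp Require Import all_classical all_reals all_analysis.
From mathcomp Require Import measurable_realfun ess_sup_inf.
From mathcomp Require Import ring lra.

Set Implicit Arguments.
Unset Strict Implicit.
Unset Printing Implicit Defensive.

Import Order.TTheory GRing.Theory Num.Theory.
Import numFieldNormedType.Exports.
Local Open Scope classical_set_scope.
Local Open Scope complex_scope.
Local Open Scope ring_scope.

(* [all_boot] also exports a [sval]. *)
Local Notation sval := Defs.sval.

(** * Positivity in C*-algebras *)

Section real_norm.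
Context (R : realType) (V : normedModType R[i]).
Implicit Types (a b : V) (r : R).

(** The norm lives in [R[i]] but is real; taking its real part brings the estimates into the ordered
    field [R], within reach of [lra] and [nra]. *)
Definition nr a : R := complex.Re `|a|.

Lemma nrE a : `|a| = (nr a)%:C.
Proof. by rewrite /nr RRe_real ?ger0_real. Qed.

Lemma nr_ge0 a : 0 <= nr a.
Proof. by have := normr_ge0 a; rewrite nrE ler0c. Qed.

Lemma nr_le a r : (`|a| <= r%:C) = (nr a <= r).
Proof. by rewrite nrE lecR. Qed.

Lemma nrD a b : nr (a + b) <= nr a + nr b.
Proof. by rewrite -lecR rmorphD/= -!nrE ler_normD. Qed.

Lemma nrN a : nr (- a) = nr a.
Proof. by rewrite /nr normrN. Qed.

Lemma nrB a b : nr (a - b) <= nr a + nr b.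
Proof. by rewrite -(nrN b) nrD. Qed.

Lemma nr_distC a b : nr (a - b) = nr (b - a).
Proof. by rewrite -nrN opprB. Qed.

Lemma nr0 : nr 0 = 0.
Proof. by rewrite /nr normr0. Qed.

Lemma nr_eq0 a : nr a <= 0 -> a = 0.
Proof.
move=> a0; apply/normr0_eq0; rewrite nrE; congr (_%:C).
by apply/eqP; rewrite eq_le a0 nr_ge0.
Qed.

Lemma nrZ (k : R[i]) a : nr (k *: a) = complex.Re `|k| * nr a.
Proof.
by apply: complexI; rewrite rmorphM/= -nrE normrZ nrE RRe_real ?ger0_real.
Qed.

Lemma nrZr r a : nr (r%:C *: a) = `|r| * nr a.
Proof. by rewrite nrZ normC_real. Qed.

Lemma nrZi a : nr ('i *: a) = nr a.
Proof. by rewrite nrZ normc_def/= expr0n add0r expr1n sqrtr1 mul1r. Qed.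

Lemma nr_cvg (f : nat -> V) a : f n @[n --> \oo] --> a <->
  (forall r, 0 < r -> \forall n \near \oo, nr (f n - a) < r).
Proof.
split=> [/cvgrPdist_lt fa r r0|fa].
  have r0' : 0 < r%:C by rewrite ltcR.
  by apply: filterS (fa _ r0') => n; rewrite nrE ltcR nr_distC.
(* A positive element of [R[i]] has zero imaginary part, so real radii suffice. *)
apply/cvgrPdist_lt => -[r r']; rewrite ltcE/= => /andP[/eqP -> r0].
by apply: filterS (fa r r0) => n; rewrite -nr_distC nrE ltcR.
Qed.

Lemma nr_cvg_unique (f : nat -> V) a b :
  f n @[n --> \oo] --> a -> f n @[n --> \oo] --> b -> a = b.
Proof. by move=> fa fb; apply: (cvg_unique _ fa fb). Qed.

Lemma nr_cvg_le (f : nat -> V) a b r : f n @[n --> \oo] --> a ->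
  (\forall n \near \oo, nr (f n - b) <= r) -> nr (a - b) <= r.
Proof.
move=> /nr_cvg fa fr; apply/ler_addgt0Pl => s s0.
have [n [fan frn]] := filter_ex (filterI (fa s s0) fr).
have -> : a - b = - (f n - a) + (f n - b) by rewrite opprB addrA subrK.
by rewrite (le_trans (nrD _ _))// nrN lerD// ltW.
Qed.

Lemma nr_near_zero a : (forall r, 0 < r -> nr a <= r) -> a = 0.
Proof.
by move=> ar; apply: nr_eq0; apply/ler_addgt0Pl => r r0; rewrite addr0 ar.
Qed.

End real_norm.

Lemma nr_complete (R : realType) (V : completeNormedModType R[i])
    (f : nat -> V) :
  (forall r : R, 0 < r -> exists N, forall m n, (N <= m)%N -> (N <= n)%N ->
     nr (f m - f n) < r) ->
  exists a : V, f n @[n --> \oo] --> a.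
Proof.
move=> fC; suff fc : cauchy (f @ \oo).
  by exists (lim (f @ \oo)); exact: (cauchy_cvg (f @ \oo)).
apply/cauchy_ballP => -[r r']; rewrite ltcE/= => /andP[/eqP -> r0].
have [N fN] := fC r r0; exists ([set f n | n in [set n | (N <= n)%N]],
        [set f n | n in [set n | (N <= n)%N]]).
  by split; exists N => // n /= Nn; exists n.
move=> [x y] [/= [m Nm <-] [n Nn <-]].
by rewrite -ball_normE/ball_/= nrE ltcR fN.
Qed.

(** * Norm identities and the square root iteration *)

Section cstar_norm.
Context (R : realType) (A : cstarAlgType R).
Implicit Types (a b x y : A) (r : R).

Lemma cmulBl a b x : cmul (a - b) x = cmul a x - cmul b x.
Proof. by rewrite cmulDl cmulNr. Qed.

Lemma cmulBr a b x : cmul x (a - b) = cmul x a - cmul x b.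
Proof. by rewrite cmulDr cmulrN. Qed.

Lemma cstarB a b : cstar (a - b) = cstar a - cstar b.
Proof. by rewrite cstarD cstarN. Qed.

Lemma cstarZr r a : cstar (r%:C *: a) = r%:C *: cstar a.
Proof. by rewrite cstarZ; congr (_ *: _); exact: conjc_real. Qed.

Lemma cstarZi a : cstar ('i *: a) = - ('i *: cstar a).
Proof.
rewrite cstarZ -scaleNr; congr (_ *: _).
by apply/eqP; rewrite eq_complex/= !oppr0 !eqxx.
Qed.

Lemma nrM a b : nr (cmul a b) <= nr a * nr b.
Proof. by rewrite -nr_le rmorphM/= -!nrE cnormM. Qed.

Lemma nr_star a : nr (cstar a) = nr a.
Proof. by rewrite /nr cnorm_star. Qed.

Lemma nr_starM a : nr (cmul (cstar a) a) = nr a ^+ 2.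
Proof. by apply: complexI; rewrite rmorphXn/= -!nrE cnorm_starM. Qed.

Lemma nr_Mstar a : nr (cmul a (cstar a)) = nr a ^+ 2.
Proof. by rewrite -{1}(cstarK a) nr_starM nr_star. Qed.

Lemma nr_sqr a : cstar a = a -> nr (cmul a a) = nr a ^+ 2.
Proof. by move=> ha; rewrite -{1}ha nr_starM. Qed.

Lemma cmul_star0 a : cmul a (cstar a) = 0 -> a = 0.
Proof.
move=> a0; apply: nr_eq0; have := nr_Mstar a; rewrite a0 nr0.
by move=> /esym/eqP; rewrite sqrf_eq0 => /eqP ->.
Qed.

(** A fixed point [y] satisfies [2 y = x + y y], that is, [u - y] is a square root of [u - x] when
    [u] is a unit. Iterating from 0 yields polynomials in [x]. *)
Definition sqrt_step x y : A := (2^-1 : R)%:C *: (x + cmul y y).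

Definition sqrt_iter x n : A := iter n (sqrt_step x) 0.

(** The scalar iteration for [x = 1]: it increases within [[0, 1]] and is a majorant for the norms
    of the iterates and of their increments. *)
Definition rsqrt_iter n : R := iter n (fun t => (1 + t ^+ 2) / 2) 0.

Lemma rsqrt_iterS n : rsqrt_iter n.+1 = (1 + rsqrt_iter n ^+ 2) / 2.
Proof. by []. Qed.

Lemma sqrt_iterS x n : sqrt_iter x n.+1 = sqrt_step x (sqrt_iter x n).
Proof. by []. Qed.

Lemma rsqrt_iter_itv n : 0 <= rsqrt_iter n <= 1.
Proof.
elim: n => [|n /andP[n0 n1]]; first by rewrite lexx ler01.
rewrite rsqrt_iterS; move: (rsqrt_iter n) n0 n1 => t t0 t1.
by apply/andP; split; nra.
Qed.

Lemma rsqrt_iter_nd n : rsqrt_iter n <= rsqrt_iter n.+1.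
Proof. by rewrite rsqrt_iterS; have := sqr_ge0 (1 - rsqrt_iter n); nra. Qed.

Lemma nr_half a : nr ((2^-1 : R)%:C *: a) = nr a / 2.
Proof. by rewrite nrZr mulrC ger0_norm// invr_ge0. Qed.

(** The factorisation [y y - t t = y (y - t) + (y - t) t] holds without commutativity. *)
Lemma sqrt_stepB x y z t : sqrt_step x y - sqrt_step z t =
  (2^-1 : R)%:C *: ((x - z) + (cmul y (y - t) + cmul (y - t) t)).
Proof.
rewrite /sqrt_step -scalerBr cmulBr cmulBl [cmul y y - _ + _]addrA subrK.
by congr (_ *: _); rewrite opprD addrACA.
Qed.

Lemma nr_sqrt_iter x n : nr x <= 1 -> nr (sqrt_iter x n) <= rsqrt_iter n.
Proof.
move=> x1; elim: n => [|n IH]; first by rewrite /sqrt_iter/= nr0.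
rewrite sqrt_iterS rsqrt_iterS nr_half ler_pM2r ?invr_gt0//.
rewrite (le_trans (nrD _ _))// lerD// (le_trans (nrM _ _))//.
by rewrite expr2 ler_pM ?nr_ge0.
Qed.

(** By [sqrt_stepB], an increment of norm at most [s - t] between iterates of norms at most [s] and
    [t] leads to one of norm at most [(s - t) (s + t) / 2], exactly the next scalar increment. *)
Lemma nr_sqrt_iterB x n : nr x <= 1 ->
  nr (sqrt_iter x n.+1 - sqrt_iter x n) <= rsqrt_iter n.+1 - rsqrt_iter n.
Proof.
move=> x1; elim: n => [|n IH].
  rewrite /sqrt_iter/= /sqrt_step cmul0r !addr0 subr0 nr_half.
  by rewrite /rsqrt_iter/= expr0n/= addr0 subr0 ler_pM2r ?invr_gt0.
rewrite 2!sqrt_iterS sqrt_stepB subrr add0r nr_half.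
have := nr_sqrt_iter n x1; have := nr_sqrt_iter n.+1 x1.
move: IH; rewrite (rsqrt_iterS n.+1) -!sqrt_iterS.
set y := sqrt_iter x n.+1; set z := sqrt_iter x n => IH y1 z1.
have /andP[t0 _] := rsqrt_iter_itv n; have /andP[s0 _] := rsqrt_iter_itv n.+1.
have := nrD (cmul y (y - z)) (cmul (y - z) z).
have := nrM y (y - z); have := nrM (y - z) z.
have := nr_ge0 y; have := nr_ge0 z; have := nr_ge0 (y - z).
have := rsqrt_iter_nd n.
set a := nr (_ + _); set b := nr (cmul y _); set c := nr (cmul (y - z) z).
move=> nd h1 h2 h3 h4 h5 h6.
have : nr y * nr (y - z) <= rsqrt_iter n.+1 * (rsqrt_iter n.+1 - rsqrt_iter n).
  exact: ler_pM.
have : nr (y - z) * nr z <= (rsqrt_iter n.+1 - rsqrt_iter n) * rsqrt_iter n.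
  exact: ler_pM.
rewrite [rsqrt_iter n.+1 in X in _ -> _ -> _ <= _ - X]rsqrt_iterS.
nra.
Qed.

End cstar_norm.

Section cstar_sqrt.
Context (R : realType) (A : cstarAlgType R).
Implicit Types (a b x y : A) (r : R).

(** [rsqrt_iter] is monotone and bounded, hence Cauchy; telescoping [nr_sqrt_iterB] transfers this
    to the iterates, and [A] is complete. *)
Lemma sqrt_iter_cvg x : nr x <= 1 ->
  exists y : A, sqrt_iter x n @[n --> \oo] --> y.
Proof.
move=> x1; apply: nr_complete => r r0.
have nd : {homo @rsqrt_iter R : n m / (n <= m)%N >-> n <= m}.
  by apply: homo_leq => //; [exact: le_trans|exact: rsqrt_iter_nd].
have ub : has_ubound (range (@rsqrt_iter R)).
  by exists 1 => _ [n _ <-]; have /andP[] := rsqrt_iter_itv R n.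
have tc := nondecreasing_is_cvgn nd ub.
have /cvgrPdist_lt /(_ r r0) [N _ tN] := tc.
have dB n k : nr (sqrt_iter x (n + k) - sqrt_iter x n) <=
    rsqrt_iter R (n + k) - rsqrt_iter R n.
  elim: k => [|k IH]; first by rewrite addn0 !subrr nr0.
  rewrite addnS -[X in nr X](subrKA (sqrt_iter x (n + k))).
  rewrite (le_trans (nrD _ _))// -[leRHS](subrKA (rsqrt_iter R (n + k))).
  by rewrite lerD// nr_sqrt_iterB.
suff tB n k : (N <= n)%N -> nr (sqrt_iter x (n + k) - sqrt_iter x n) < r.
  exists N => m n Nm Nn; have [nm|/ltnW mn] := leqP n m.
    by rewrite -(subnKC nm) tB.
  by rewrite nr_distC -(subnKC mn) tB.
move=> Nn; apply: (le_lt_trans (dB _ _)).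
apply: (@le_lt_trans _ _ (limn (@rsqrt_iter R) - rsqrt_iter R n)).
  by rewrite lerD2r; exact: nondecreasing_cvgn_le.
by apply: le_lt_trans (tN n Nn); exact: ler_norm.
Qed.

Section limit.
Variables x y : A.
Hypothesis xy : sqrt_iter x n @[n --> \oo] --> y.

Lemma sqrt_iter_lim : y = sqrt_step x y.
Proof.
have := xy; rewrite -cvg_shiftS => xSy; apply: (nr_cvg_unique xSy).
rewrite /sqrt_step/=; apply: cvgZ; first exact: cvg_cst.
by apply: cvgD; [exact: cvg_cst|exact: cvg_cmul].
Qed.

Lemma sqrt_iter_lim2 : y + y = x + cmul y y.
Proof.
rewrite [in LHS]sqrt_iter_lim -scalerDl -rmorphD/=.
rewrite (_ : 2^-1 + 2^-1 = 1 :> R) ?scale1r//.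
by rewrite -mulr2n -[_ *+ 2]mulr_natl divff.
Qed.

Lemma nr_sqrt_iter_lim : nr x <= 1 -> nr y <= 1.
Proof.
move=> x1; rewrite -[y]subr0; apply: (nr_cvg_le xy).
apply: nearW => n; rewrite subr0 (le_trans (nr_sqrt_iter _ x1))//.
by have /andP[] := rsqrt_iter_itv R n.
Qed.

Lemma sqrt_iter_lim_star : cstar x = x -> cstar y = y.
Proof.
move=> hx; apply: (nr_cvg_unique (cvg_cstar xy)).
suff -> : (fun n => cstar (sqrt_iter x n)) = sqrt_iter x by [].
apply/funext; elim=> [|n IH]; first exact: cstar0.
by rewrite sqrt_iterS /sqrt_step cstarZr cstarD cstarM hx IH.
Qed.

(** Every iterate is a polynomial in [x], hence commutes with whatever commutes with [x]; so does
    the limit. *)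
Lemma sqrt_iter_lim_comm z : cmul z x = cmul x z -> cmul z y = cmul y z.
Proof.
move=> zx; apply: (nr_cvg_unique (cvg_cmul (@cvg_cst _ z _ _ _) xy)).
suff -> : (fun n => cmul z (sqrt_iter x n)) = (fun n => cmul (sqrt_iter x n) z).
  by apply: cvg_cmul xy _; exact: cvg_cst.
apply/funext; elim=> [|n IH]; first by rewrite /= cmulr0 cmul0r.
rewrite sqrt_iterS /sqrt_step cmulZr cmulZl cmulDr cmulDl zx.
by rewrite cmulA IH -cmulA IH cmulA.
Qed.

End limit.

End cstar_sqrt.

(** * The positive cone of a unital C*-algebra *)

Section cstar_positive.
Context (R : realType) (A : cstarAlgType R) (u : A) (unitu : cunit u).
Implicit Types (a b c h k w x y z : A) (r t : R).

Let mul1 a : cmul u a = a. Proof. by have [] := unitu a. Qed.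
Let mulu a : cmul a u = a. Proof. by have [] := unitu a. Qed.

Lemma cunit_star : cstar u = u.
Proof. by rewrite -[LHS]mulu -{2}(cstarK u) -cstarM mulu cstarK. Qed.

(** The unit is a self-adjoint idempotent, so its norm equals its own square and is 0 or 1. *)
Lemma nr_cunit : nr u <= 1.
Proof.
have := nr_sqr cunit_star; rewrite mul1 => /eqP.
rewrite expr2 -subr_eq0 -{1}[nr u]mulr1 -mulrBr mulf_eq0.
by move=> /orP[/eqP ->|]; [exact: ler01|rewrite subr_eq0 => /eqP <-].
Qed.

(* The Kelley-Vaught description of the positive cone: since it refers to the
   norm alone, it is visibly a closed convex cone. *)
Definition kvpos h :=
  cstar h = h /\ exists2 t, 0 <= t & nr (t%:C *: u - h) <= t.

Lemma kvposD h k : kvpos h -> kvpos k -> kvpos (h + k).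
Proof.
move=> [hh [t t0 th]] [hk [s s0 sk]]; split; first by rewrite cstarD hh hk.
exists (t + s); first exact: addr_ge0.
rewrite rmorphD/= scalerDl opprD addrACA (le_trans (nrD _ _))//.
exact: lerD.
Qed.

(** [b] and [c] are the real and imaginary parts of [v = b + i c]. As they commute, [v] times its
    adjoint is [b b + c c], so the C*-identity bounds [v], and [b] is the mean of [v] and
    [cstar v]. *)
Lemma commuting_squares_bound b c t : cstar b = b -> cstar c = c ->
  cmul b c = cmul c b -> cmul b b + cmul c c = t%:C *: u -> 0 <= t ->
  nr b ^+ 2 <= t.
Proof.
move=> hb hc bc bct t0; pose v := b + 'i *: c.
have vs : cstar v = b - 'i *: c by rewrite cstarD cstarZi hb hc.
have : nr v ^+ 2 <= t.
  rewrite -nr_Mstar vs /v cmulBr !cmulDl !cmulZl !cmulZr bc.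
  rewrite opprD addrA addrK scalerA -expr2 sqr_i scaleN1r opprK bct.
  by rewrite nrZr ger0_norm// ler_piMr// nr_cunit.
apply: le_trans; rewrite ler_pXn2r ?nnegrE ?nr_ge0//.
have -> : b = (2^-1 : R)%:C *: (v + cstar v).
  rewrite vs /v addrACA subrr addr0 -mulr2n -[b *+ 2]scaler_nat scalerA.
  rewrite (_ : _ * _ = 1) ?scale1r//.
  by rewrite -(rmorph_nat (real_complex R)) -rmorphM/= mulVf.
rewrite nr_half ler_pdivrMr// (le_trans (nrD _ _))// nr_star.
by rewrite mulr_natr mulr2n.
Qed.

Lemma sqrt_iter_sqr x y : sqrt_iter x n @[n --> \oo] --> y ->
  cmul (u - y) (u - y) = u - x.
Proof.
move=> /sqrt_iter_lim2 yx; rewrite cmulBl !cmulBr mul1 mulu mul1.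
rewrite -addrA; congr (_ + _).
by rewrite opprB addrC -addrA -opprD yx opprD addrCA subrr addr0.
Qed.

(** For [t > 0], the element [x = u - h / t] has norm at most 1 and the iteration gives a root
    [u - y] of [h / t]. It is positive since [nr y <= 1], and commutes with whatever commutes with
    [h] since [y] is a limit of polynomials in [x]. *)
Lemma kvpos_sqrt h : kvpos h -> exists b, [/\ cstar b = b, cmul b b = h, kvpos b
  & forall z, cmul z h = cmul h z -> cmul z b = cmul b z].
Proof.
move=> [hh [t t0 th]]; move: t0; rewrite le_eqVlt => /orP[/eqP t0|t0].
  have h0 : h = 0.
    by apply: nr_eq0; move: th; rewrite -t0 scale0r add0r nrN.
  rewrite h0; exists 0; rewrite cstar0 cmulr0; split=> //.
  split; first exact: cstar0.
  by exists 0 => //; rewrite scale0r subr0 nr0.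
pose x := u - (t^-1)%:C *: h.
have hx : cstar x = x by rewrite cstarB cstarZr cunit_star hh.
have x1 : nr x <= 1.
  have -> : x = (t^-1)%:C *: (t%:C *: u - h).
    by rewrite scalerBr scalerA -rmorphM/= mulVf ?gt_eqF// scale1r.
  by rewrite nrZr gtr0_norm ?invr_gt0// mulrC ler_pdivrMr ?mul1r.
have [y xy] := sqrt_iter_cvg x1.
have hy := sqrt_iter_lim_star xy hx.
have hb : cstar ((Num.sqrt t)%:C *: (u - y)) = (Num.sqrt t)%:C *: (u - y).
  by rewrite cstarZr cstarB cunit_star hy.
exists ((Num.sqrt t)%:C *: (u - y)); split=> // [||z zh].
- rewrite cmulZl cmulZr scalerA -rmorphM/= -expr2 sqr_sqrtr ?ltW//.
  rewrite (sqrt_iter_sqr xy) opprB addrC subrK scalerA -rmorphM/=.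
  by rewrite divff ?gt_eqF// scale1r.
- split=> //; exists (Num.sqrt t); first exact: sqrtr_ge0.
  rewrite -scalerBr opprB addrC subrK nrZr ger0_norm ?sqrtr_ge0//.
  by rewrite ler_piMr ?sqrtr_ge0// (nr_sqrt_iter_lim xy x1).
- have zx : cmul z x = cmul x z.
    by rewrite cmulBr cmulBl mul1 mulu cmulZl cmulZr zh.
  rewrite cmulZl cmulZr cmulBr cmulBl mul1 mulu.
  by rewrite (sqrt_iter_lim_comm xy zx).
Qed.

(** The iteration at [b b / t] yields a self-adjoint [c], commuting with [b], with
    [c c = t u - b b]; then [commuting_squares_bound] bounds [nr c]. The freedom in [t] lets
    [positive_closed] use one [t] for all approximants. *)
Lemma kvpos_sqr b t : cstar b = b -> nr b ^+ 2 <= t -> 0 < t ->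
  nr (t%:C *: u - cmul b b) <= t.
Proof.
move=> hb bt t0; pose x := (t^-1)%:C *: cmul b b.
have hx : cstar x = x by rewrite cstarZr cstarM hb.
have x1 : nr x <= 1.
  by rewrite nrZr gtr0_norm ?invr_gt0// nr_sqr// mulrC ler_pdivrMr ?mul1r.
have [y xy] := sqrt_iter_cvg x1; have hy := sqrt_iter_lim_star xy hx.
pose c := (Num.sqrt t)%:C *: (u - y).
have hc : cstar c = c by rewrite cstarZr cstarB cunit_star hy.
have cc : cmul c c = t%:C *: u - cmul b b.
  rewrite cmulZl cmulZr scalerA -rmorphM/= -expr2 sqr_sqrtr ?ltW//.
  rewrite (sqrt_iter_sqr xy) scalerBr scalerA -rmorphM/=.
  by rewrite divff ?gt_eqF// scale1r.
have bx : cmul b x = cmul x b by rewrite cmulZl cmulZr cmulA.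
have bc : cmul c b = cmul b c.
  rewrite cmulZl cmulZr cmulBr cmulBl mul1 mulu.
  by rewrite (sqrt_iter_lim_comm xy bx).
rewrite -cc nr_sqr//; apply: (commuting_squares_bound hc hb bc _ (ltW t0)).
by rewrite cc subrK.
Qed.

Lemma sqr_kvpos b : cstar b = b -> kvpos (cmul b b).
Proof.
move=> hb; split; first by rewrite cstarM hb.
have t0 : 0 < nr b ^+ 2 + 1 by rewrite ltr_wpDl ?sqr_ge0.
by exists (nr b ^+ 2 + 1); [exact: ltW|apply: kvpos_sqr => //; rewrite lerDl].
Qed.

(** The roots [b] of [h] and [c] of [- h] commute and their squares sum to 0, so
    [commuting_squares_bound] applies with [t = 0]. *)
Lemma kvpos_anti h : kvpos h -> kvpos (- h) -> h = 0.
Proof.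
move=> /kvpos_sqrt[b [hb bh _ bC]] /kvpos_sqrt[c [hc ch _ cC]].
have hb' : cmul h b = cmul b h by rewrite -bh cmulA.
have bc : cmul b c = cmul c b by apply: cC; rewrite cmulrN cmulNr hb'.
have /(commuting_squares_bound hb hc bc)/(_ (lexx 0)) b0 :
  cmul b b + cmul c c = (0 : R)%:C *: u by rewrite bh ch subrr scale0r.
by apply: nr_eq0; rewrite -bh nr_sqr.
Qed.

(* With [v := w^* s], the sum [v v^* + v^* v] is minus a sum of two squares,
   while for every [v] it is half a sum of two squares. *)
Lemma neg_sqr_eq0 w s : cstar s = s -> cmul w (cstar w) = - cmul s s -> w = 0.
Proof.
move=> hs ws; pose W := cmul (cstar w) w; pose v := cmul (cstar w) s.
have hW : cstar W = W by rewrite cstarM cstarK.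
have vs : cstar v = cmul s w by rewrite cstarM cstarK hs.
have vvs : cmul v (cstar v) = - cmul W W.
  rewrite vs /v -cmulA (cmulA s) -[cmul s s]opprK -ws cmulNr cmulrN.
  by rewrite /W !cmulA.
pose s2 := cmul s s; have hs2 : cstar s2 = s2 by rewrite cstarM hs.
have vsv : cmul (cstar v) v = - cmul s2 s2.
  rewrite vs /v -cmulA (cmulA w) ws cmulNr cmulrN /s2.
  by rewrite !cmulA.
pose p := v + cstar v; pose q := 'i *: (v - cstar v).
have hp : cstar p = p by rewrite cstarD cstarK addrC.
have hq : cstar q = q by rewrite cstarZi cstarB cstarK -scalerN opprB.
have pq : cmul p p + cmul q q = (cmul v (cstar v) + cmul (cstar v) v) *+ 2.
  rewrite /p /q cmulZl cmulZr scalerA -expr2 sqr_i scaleN1r.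
  rewrite cmulBl !cmulBr cmulDl !cmulDr.
  set x := cmul v v; set y := cmul v (cstar v); set z := cmul (cstar v) v.
  set r := cmul (cstar v) (cstar v).
  have -> : x + y + (z + r) = (x + r) + (y + z).
    by rewrite [z + r]addrC addrACA.
  have -> : x - y - (z - r) = (x + r) - (y + z).
    by rewrite opprB addrACA -opprD.
  by rewrite opprB addrC addrA subrK -mulr2n.
have : cmul W W = 0.
  apply: kvpos_anti; first exact: sqr_kvpos.
  have -> : - cmul W W = (2^-1 : R)%:C *: (cmul p p + cmul q q) + cmul s2 s2.
    rewrite pq -[(_ + _) *+ 2]scaler_nat scalerA (_ : _ * _ = 1) ?scale1r.
      by rewrite vvs vsv subrK.
    by rewrite -(rmorph_nat (real_complex R)) -rmorphM/= mulVf.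
  apply: kvposD; last exact: sqr_kvpos.
  have half x : cstar x = x -> kvpos ((2^-1 : R)%:C *: cmul x x).
    move=> hx; pose k := (Num.sqrt (2^-1 : R))%:C.
    have -> : (2^-1 : R)%:C *: cmul x x = cmul (k *: x) (k *: x).
      by rewrite cmulZl cmulZr scalerA -rmorphM/= -expr2 sqr_sqrtr ?invr_ge0.
    by apply: sqr_kvpos; rewrite cstarZr hx.
  by rewrite scalerDr; apply: kvposD; exact: half.
rewrite -{2}hW => /cmul_star0; rewrite /W -{2}(cstarK w) => /cmul_star0 w0.
by rewrite -(cstarK w) w0 cstar0.
Qed.

(** Here [k = |h|], [m = |h| - h] is twice the negative part of [h], and [r] is a root of [k]. Since
    [h m = - k m], the product of [m z] and its adjoint is [- (r m) (r m)], so [m z = 0] by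
    [neg_sqr_eq0]; from there [m = 0] and [h = k]. *)
Lemma kvpos_star z : kvpos (cmul z (cstar z)).
Proof.
set h := cmul z (cstar z).
have hh : cstar h = h by rewrite cstarM cstarK.
have [k [hk kh kpos kC]] := kvpos_sqrt (sqr_kvpos hh).
have [r [hr rk _ rC]] := kvpos_sqrt kpos.
pose m := k - h.
have hm : cstar m = m by rewrite cstarB hk hh.
have hkC : cmul h k = cmul k h by apply: kC; rewrite cmulA.
have mk : cmul m k = cmul k m by rewrite cmulBl cmulBr hkC.
have mr : cmul m r = cmul r m by exact: rC.
have hmE : cmul h m = - cmul k m by rewrite !cmulBr hkC kh opprB.
have w0 : cmul m z = 0.
  apply: (@neg_sqr_eq0 _ (cmul r m)); first by rewrite cstarM hm hr.
  rewrite cstarM hm -!cmulA (cmulA z) -/h hmE cmulrN; congr (- _).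
  by rewrite -rk -[cmul (cmul r r) m]cmulA (cmulA m) mr -cmulA.
(* [(r m) (r m) = m k m = - m h m], which contains the factor [m z = 0]. *)
have rm0 : cmul r m = 0.
  have : cmul (cmul r m) (cmul r m) = 0.
    rewrite -{1}mr -cmulA (cmulA r) rk -[cmul k m]opprK -hmE cmulrN.
    by rewrite /h -!cmulA cmulA w0 cmul0r oppr0.
  have {2}<- : cstar (cmul r m) = cmul r m by rewrite cstarM hm hr.
  exact: cmul_star0.
have km0 : cmul k m = 0 by rewrite -rk -cmulA rm0 cmulr0.
have : cmul m m = 0 by rewrite {1}/m cmulBl hmE km0 oppr0 subr0.
rewrite -{2}hm => /cmul_star0/eqP; rewrite subr_eq0 => /eqP <-.
exact: kpos.
Qed.

(** The self-adjoint roots [b] of [u - a] and [c] of [u + a] commute, and [b b + c c = 2 u]; hence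
    [nr b ^+ 2 <= 2], and [a = u - b b] has norm at most [1 + 2]. *)
Lemma positive_bound a : cpositive (u - a) -> cpositive (u + a) -> nr a <= 3.
Proof.
move=> [z za] [y ya].
have := kvpos_star z; have := kvpos_star y; rewrite -za -ya.
move=> /kvpos_sqrt[c [hc ch _ cC]] /kvpos_sqrt[b [hb bh _ bC]].
have bc : cmul b c = cmul c b.
  apply: cC; have : cmul b a = cmul a b.
    have : cmul b (u - a) = cmul (u - a) b by rewrite -bh cmulA.
    by rewrite cmulBr cmulBl mul1 mulu => /addrI/oppr_inj.
  by rewrite cmulDr cmulDl mul1 mulu => ->.
have /(commuting_squares_bound hb hc bc)/(_ (ler0n _ _)) b2 :
    cmul b b + cmul c c = (2 : R)%:C *: u.
  rewrite bh ch addrACA addNr addr0 -mulr2n -[u *+ 2]scaler_nat.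
  by rewrite rmorph_nat.
have -> : a = u - cmul b b by rewrite bh opprB addrC subrK.
rewrite (le_trans (nrB _ _))// nr_sqr//.
by have := nr_cunit; lra.
Qed.

(** For a fixed [t] the inequality in [kvpos] is a closed condition. With [t = nr h + 1] it holds at
    every positive element within 1 of [h], by [kvpos_sqr], hence at [h], which then has a
    self-adjoint root. *)
Lemma positive_closed h :
  (forall r, 0 < r -> exists2 k, cpositive k & nr (h - k) <= r) -> cpositive h.
Proof.
move=> hP.
have hh : cstar h = h.
  apply/eqP; rewrite -subr_eq0; apply/eqP/nr_near_zero => r r0.
  have r20 : 0 < r / 2 by exact: divr_gt0.
  have [k [z kz] hk] := hP _ r20.
  have -> : cstar h - h = cstar (h - k) - (h - k).
    by rewrite cstarB kz cstarM cstarK opprB addrA subrK.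
  by rewrite (le_trans (nrB _ _))// nr_star (splitr r) lerD.
suff /kvpos_sqrt[b [hb <- _ _]] : kvpos h by exists b; rewrite hb.
split=> //; exists (nr h + 1); first by rewrite addr_ge0 ?nr_ge0.
apply/ler_addgt0Pl => r r0.
have r10 : 0 < Num.min r 1 by rewrite lt_min r0 ltr01.
have [k [z kz]] := hP _ r10; rewrite le_min => /andP[hkr hk1].
have /kvpos_sqrt[b [hb bk _ _]] := kvpos_star z.
have k1 : nr b ^+ 2 <= nr h + 1.
  rewrite -nr_sqr// bk -kz -(subKr h k).
  by rewrite (le_trans (nrB _ _))// lerD2l.
have t0 : 0 < nr h + 1 by rewrite ltr_wpDl ?nr_ge0.
have := kvpos_sqr hb k1 t0; rewrite bk -kz => kt.
rewrite -(subrKA k) addrC (le_trans (nrD _ _))// lerD//.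
by rewrite nr_distC.
Qed.

End cstar_positive.

(** * Extension from a dense subspace *)

Section linear_extension.
Context (R : realType) (V : completeNormedModType R[i]).
Variables (S : V -> V -> Prop) (C : R).
Hypothesis S_linear : forall (k : R[i]) a b a' b',
  S a b -> S a' b' -> S (k *: a + a') (k *: b + b').
Hypothesis S_dense : forall a (r : R), 0 < r ->
  exists a' b', S a' b' /\ nr (a - a') < r.
Hypothesis C0 : 0 <= C.
Hypothesis S_bound : forall a b, S a b -> nr b <= C * nr a.

(** The closure of the graph [S]. *)
Let G a b := forall r : R, 0 < r ->
  exists a' b', [/\ S a' b', nr (a - a') < r & nr (b - b') < r].

Let G_S a b : S a b -> G a b.
Proof. by move=> Sab r r0; exists a, b; rewrite !subrr !nr0. Qed.

Let S_sub a b a' b' : S a b -> S a' b' -> S (a' - a) (b' - b).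
Proof.
by move=> /(S_linear (-1))/[apply]; rewrite !scaleN1r ![- _ + _]addrC.
Qed.

Let G_total a : exists b, G a b.
Proof.
have rn n : 0 < n.+1%:R^-1 :> R by rewrite invr_gt0.
have /choice[f fP] n : exists p : V * V,
    S p.1 p.2 /\ nr (a - p.1) < n.+1%:R^-1.
  by have [a' [b' ab']] := S_dense a (rn n); exists (a', b').
(* Images of two points within [q] of [a] differ by at most [(C + C) q]; the [+ 1] makes the
   estimate strict and the divisor positive. *)
have CC : 0 < C + C + 1 by rewrite ltr_wpDl// addr_ge0.
have small r : 0 < r -> exists N, forall n, (N <= n)%N ->
    nr (a - (f n).1) < r.
  move=> r0; have [N _ NP] := near_infty_natSinv_lt (PosNum r0).
  exists N => n Nn; have [_ /lt_trans] := fP n; apply; exact: NP.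
have [b fb] : exists b : V, (f n).2 @[n --> \oo] --> b.
  apply: nr_complete => r r0; have [N NP] := small _ (divr_gt0 r0 CC).
  exists N => m n Nm Nn; have [Sm _] := fP m; have [Sn _] := fP n.
  apply: le_lt_trans (S_bound (S_sub Sn Sm)) _.
  have h : nr ((f m).1 - (f n).1) <= (r / (C + C + 1)) *+ 2.
    have -> : (f m).1 - (f n).1 = (a - (f n).1) - (a - (f m).1).
      by rewrite opprB [RHS]addrC subrKA.
    by rewrite (le_trans (nrB _ _))// mulr2n lerD// ltW// NP.
  apply: le_lt_trans (ler_wpM2l C0 h) _.
  have q0 : 0 < r / (C + C + 1) by exact: divr_gt0.
  have : r = (C + C + 1) * (r / (C + C + 1)) by rewrite mulrC divfK// gt_eqF.
  by rewrite mulr2n; lra.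
exists b => r r0; have [N NP] := small _ r0.
have /nr_cvg/(_ r r0)[M _ MP] := fb.
exists (f (N + M)%N).1, (f (N + M)%N).2; split.
- by have [] := fP (N + M)%N.
- by apply: NP; exact: leq_addr.
- by rewrite nr_distC; apply: MP; exact: leq_addl.
Qed.

Let G_bound a b : G a b -> nr b <= C * nr a.
Proof.
move=> Gab; apply/ler_addgt0Pl => r r0.
have C1 : 0 < C + 1 by rewrite ltr_wpDl.
have [a' [b' [Sab aa' bb']]] := Gab _ (divr_gt0 r0 C1).
rewrite -(subrK b' b) (le_trans (nrD _ _))//.
have := S_bound Sab; have : nr a' <= nr a + r / (C + 1).
  by rewrite -(subKr a a') (le_trans (nrB _ _))// lerD2l ltW.
move=> /(ler_wpM2l C0) h1 h2.
have : r = (C + 1) * (r / (C + 1)) by rewrite mulrC divfK// gt_eqF.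
move: h1; rewrite mulrDr; lra.
Qed.

Let G_linear (k : R[i]) a b a' b' :
  G a b -> G a' b' -> G (k *: a + a') (k *: b + b').
Proof.
move=> Gab Gab' r r0; pose K := complex.Re `|k|.
have K0 : 0 <= K by have := normr_ge0 k; rewrite lecE/= => /andP[].
have K1 : 0 < K + 1 by rewrite ltr_wpDl.
have [c [e [Sce ac be]]] := Gab _ (divr_gt0 r0 K1).
have [c' [e' [Sce' ac' be']]] := Gab' _ (divr_gt0 r0 K1).
exists (k *: c + c'), (k *: e + e'); split; first exact: S_linear.
- rewrite opprD addrACA -scalerBr (le_lt_trans (nrD _ _))// nrZ -/K.
  have : r = (K + 1) * (r / (K + 1)) by rewrite mulrC divfK// gt_eqF.
  have := ler_wpM2l K0 (ltW ac); lra.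
- rewrite opprD addrACA -scalerBr (le_lt_trans (nrD _ _))// nrZ -/K.
  have : r = (K + 1) * (r / (K + 1)) by rewrite mulrC divfK// gt_eqF.
  have := ler_wpM2l K0 (ltW be); lra.
Qed.

Let G_fun a b b' : G a b -> G a b' -> b = b'.
Proof.
move=> Gb Gb'; apply/eqP; rewrite -subr_eq0; apply/eqP/nr_eq0.
(* By linearity [G] relates 0 to [b - b'], which the bound forces to be 0. *)
have := G_bound (G_linear (-1) Gb' Gb).
by rewrite !scaleN1r addNr nr0 mulr0 addrC.
Qed.

(** [G] is the graph of the extension: total by density and completeness, single-valued by the
    bound. With a relation as data, well-definedness on the dense subspace comes out of [S_bound] as
    well. *)
Lemma linear_extension : exists T : {linear V -> V},
  (forall a b, S a b -> T a = b) /\ forall a, nr (T a) <= C * nr a.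
Proof.
have [f fG] := choice G_total.
have f_linear : linear f.
  by move=> k a b; apply: G_fun (fG _) _; exact: G_linear.
pose fL := GRing.isLinear.Build _ _ _ _ f f_linear.
pose T : {linear V -> V} := HB.pack f fL.
exists T; split=> [a b /G_S Gab|a]; last exact: G_bound (fG a).
exact: G_fun (fG a) Gab.
Qed.

End linear_extension.

(** * Sections and liftings *)

Section sqrt_iter_stability.
Context (R : realType) (A : cstarAlgType R).
Implicit Types s x y : A.

(** [(3/4 + 1/4) / 2 = 1/2], so the ball of radius 1/2 is stable. The slack from 1/2 to 3/4 leaves
    room for approximants of an element of norm at most 1/2. *)
Lemma nr_sqrt_iter_half s n : nr s <= 3 / 4 -> nr (sqrt_iter s n) <= 1 / 2.
Proof.
move=> s34; elim: n => [|n IH]; first by rewrite /sqrt_iter/= nr0 divr_ge0.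
rewrite sqrt_iterS nr_half.
have := nrD s (cmul (sqrt_iter s n) (sqrt_iter s n)).
have := nrM (sqrt_iter s n) (sqrt_iter s n).
have := ler_pM (nr_ge0 _) (nr_ge0 _) IH IH; lra.
Qed.

Lemma nr_sqrt_iter_lim_half x y : sqrt_iter x n @[n --> \oo] --> y ->
  nr x <= 1 / 2 -> nr y <= 1 / 2.
Proof.
move=> xy x2; rewrite -[y]subr0; apply: (nr_cvg_le xy); apply: nearW => n.
by rewrite subr0 nr_sqrt_iter_half//; lra.
Qed.

(** On the ball of radius 1/2 the step contracts by 1/2, and it also halves the error [d] of [s]: a
    bound [d + 2^-n] becomes [(d + d + 2^-n) / 2 = d + 2^-(n+1)]. *)
Lemma sqrt_iter_dist x y s n : sqrt_iter x n @[n --> \oo] --> y ->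
  nr x <= 1 / 2 -> nr s <= 3 / 4 ->
  nr (sqrt_iter s n - y) <= nr (s - x) + 2^-1 ^+ n.
Proof.
move=> xy x2 s34; have y2 := nr_sqrt_iter_lim_half xy x2.
elim: n => [|n IH].
  rewrite /sqrt_iter/= sub0r nrN expr0.
  by have := nr_ge0 (s - x); lra.
rewrite sqrt_iterS {1}(sqrt_iter_lim xy) sqrt_stepB nr_half exprS.
have q2 := nr_sqrt_iter_half n s34; set q := sqrt_iter s n in q2 IH *.
have := nrD (s - x) (cmul q (q - y) + cmul (q - y) y).
have := nrD (cmul q (q - y)) (cmul (q - y) y).
have := nrM q (q - y); have := nrM (q - y) y.
have := ler_pM (nr_ge0 _) (nr_ge0 _) IH y2.
have := ler_pM (nr_ge0 _) (nr_ge0 _) q2 IH.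
have : 0 <= 2^-1 ^+ n :> R by rewrite exprn_ge0 ?invr_ge0.
lra.
Qed.

(** A diagonal sequence, since a measurable section must be the limit of one sequence of simple
    sections; the rate in [sqrt_iter_dist] makes it converge. *)
Lemma sqrt_iter_diag x y (s : nat -> A) :
  sqrt_iter x n @[n --> \oo] --> y -> nr x <= 1 / 2 ->
  s n @[n --> \oo] --> x -> sqrt_iter (s n) n @[n --> \oo] --> y.
Proof.
move=> xy x2 /nr_cvg sx; apply/nr_cvg => r r0.
have r20 : 0 < r / 2 by exact: divr_gt0.
have e0 : 0 < 1 / 4 :> R by exact: divr_gt0.
have : (2^-1 : R) ^+ n @[n --> \oo] --> 0.
  by apply: cvg_expr; rewrite ger0_norm ?invr_ge0// invf_lt1// ltr1n.
move=> /cvgrPdist_lt/(_ _ r20) h.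
apply: filterS3 h (sx _ r20) (sx _ e0) => n h1 h2 h3.
have s34 : nr (s n) <= 3 / 4.
  by rewrite -(subrK x (s n)) (le_trans (nrD _ _))//; lra.
have := sqrt_iter_dist n xy x2 s34.
move: h1; rewrite sub0r normrN ger0_norm ?exprn_ge0 ?invr_ge0//; lra.
Qed.

End sqrt_iter_stability.

(** * Measurable square roots and pointwise values of classes *)

Section measurable_sections.
Context d (Omega : measurableType d) (R : realType).
Variable mu : completeFiniteMeasure Omega R.
Variable X : cstarBundle mu.
Implicit Types (u v s : psection X) (x y : Lsec X).

Lemma simple_sqrt_iter s n : simple_section s -> exists2 t : psection X,
  simple_section t &
  \forall w \ae mu, t w = Some (sqrt_iter (sval s w) n).
Proof.
move=> ss; elim: n => [|n [t st tE]].
  by exists (fun w => Some 0); [exact: simple0|exact: aeW].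
(* The factor [\1_setT] brings the constant into the form handled by [simple_scale_indic]. *)
exists (sscale (fun w => (2^-1 : R)%:C * \1_setT w) (sadd s (smul t t))).
  by apply: simple_scale_indic => //; exact/simple_add/simple_mul.
apply: filterS2 (simple_ae ss) tE => w /svalE sE tE.
by rewrite /sscale /sadd /smul tE sE/= indicT mulr1.
Qed.

(** The [n]-th iterate at the [n]-th simple approximant of [u] agrees almost everywhere with a
    simple section, and these converge by [sqrt_iter_diag]. *)
Lemma measurable_sqrt u : measurable_section u ->
  (\forall w \ae mu, nr (sval u w) <= 1 / 2) ->
  exists2 v : psection X, measurable_section v &
    \forall w \ae mu, v w /\ sqrt_iter (sval u w) n @[n --> \oo] --> sval v w.
Proof.
move=> [s ss su] u2.
(* Where the iteration diverges, on a null set only, [lim] is arbitrary. *)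
pose v : psection X := fun w =>
  Some (lim (sqrt_iter (sval u w) n @[n --> \oo])).
have uv : \forall w \ae mu, sqrt_iter (sval u w) n @[n --> \oo] --> sval v w.
  apply: filterS u2 => w u2.
  have /sqrt_iter_cvg[y uy] : nr (sval u w) <= 1 by lra.
  by rewrite /v /sval/= (cvg_lim _ uy).
exists v; last by apply: filterS uv.
have /choice[t tP] n : exists t : psection X, simple_section t /\
    \forall w \ae mu, t w = Some (sqrt_iter (sval (s n) w) n).
  by have [t st tE] := simple_sqrt_iter n (ss n); exists t.
exists t => [n|]; first by have [] := tP n.
(* Countably many null sets are merged, so that one exceptional set serves all [n]. *)
have tE : \forall w \ae mu, forall n,
    t n w = Some (sqrt_iter (sval (s n) w) n).
  apply: (@negligibleS _ _ _ mu
    (\bigcup_n ~` [set w | t n w = Some (sqrt_iter (sval (s n) w) n)])).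
    by move=> w /= /existsNP[n sn]; exists n.
  by apply: negligible_bigcup => n; have [] := tP n.
apply: filterS2 (filterI su u2) (filterI uv tE) => w [[_ suw] u2w] [uvw tw].
split=> //; rewrite (_ : (fun n => sval (t n) w) =
    (fun n => sqrt_iter (sval (s n) w) n)).
  exact: sqrt_iter_diag uvw u2w suw.
by apply/funext => n; rewrite {1}/sval tw.
Qed.

(** With these values, identities in the quotient become almost everywhere identities in the
    fibres. *)
Definition Lval x w : X w := sval (msection_fun (repr x)) w.

Lemma repr_val x : \forall w \ae mu, msection_fun (repr x) w = Some (Lval x w).
Proof. by apply: filterS (msection_ae (msectionP (repr x))) => w /svalE. Qed.

Lemma Lmem_val x u : Lmem x u -> \forall w \ae mu, u w = Some (Lval x w).
Proof. by move=> /LmemP[_ xu]; apply: filterS2 xu (repr_val x) => w <-. Qed.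

Lemma Lsec_eq x y : (\forall w \ae mu, Lval x w = Lval y w) -> x = y.
Proof.
move=> xy; have [hu xu] := Lmem_repr x.
have [hu' yu] : Lmem y (msection_fun (repr x)).
  apply/LmemP; split; first exact: msectionP.
  by apply: filterS3 xy (repr_val x) (repr_val y) => w xy -> ->; rewrite xy.
by rewrite xu yu; congr Lclass; exact: Prop_irrelevance.
Qed.

Lemma Lval_add x y : \forall w \ae mu, Lval (Ladd x y) w = Lval x w + Lval y w.
Proof.
apply: filterS3 (Lmem_val (Lmem_add (Lmem_repr x) (Lmem_repr y)))
  (repr_val x) (repr_val y) => w + xE yE.
by rewrite /sadd xE yE => -[].
Qed.

Lemma Lval_mul x y :
  \forall w \ae mu, Lval (Lmul x y) w = cmul (Lval x w) (Lval y w).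
Proof.
apply: filterS3 (Lmem_val (Lmem_mul (Lmem_repr x) (Lmem_repr y)))
  (repr_val x) (repr_val y) => w + xE yE.
by rewrite /smul xE yE => -[].
Qed.

Lemma Lval_star x : \forall w \ae mu, Lval (Lstar x) w = cstar (Lval x w).
Proof.
apply: filterS2 (Lmem_val (Lmem_star (Lmem_repr x))) (repr_val x) => w + xE.
by rewrite /sstar xE => -[].
Qed.

Lemma Lval_scale f g x : L0mem f g ->
  \forall w \ae mu, Lval (Lscale f x) w = g w *: Lval x w.
Proof.
move=> fg.
apply: filterS2 (Lmem_val (Lmem_scale fg (Lmem_repr x))) (repr_val x) => w + xE.
by rewrite /sscale xE => -[].
Qed.

Lemma Lvnorm_val x : L0mem (Lvnorm x) (fun w => `|Lval x w|).
Proof. exact: Lmem_vnorm (Lmem_repr x). Qed.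

Lemma Linf_bound (f : L0 mu) g (r : R) : L0mem f g -> 0 <= r ->
  (\forall w \ae mu, `|g w| <= r%:C) -> Linf f.
Proof.
(* [Linf] asks for a positive bound, and [r] may be 0. *)
move=> /L0memP[_ fg] r0 gr; exists (r + 1); first by rewrite ltr_wpDl.
by apply: filterS2 fg gr => w -> /le_trans; apply; rewrite lecR lerDl.
Qed.

Lemma Linf_secP x :
  Linf_sec x <-> exists2 r : R, 0 <= r & \forall w \ae mu, nr (Lval x w) <= r.
Proof.
split=> [[r r0 xr]|[r r0 xr]].
  exists r; first exact: ltW.
  have /L0memP[_ xn] := Lvnorm_val x.
  by apply: filterS2 xn xr => w ->; rewrite normr_id nr_le.
apply: (Linf_bound (Lvnorm_val x) r0); apply: filterS xr => w.
by rewrite normr_id nr_le.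
Qed.

End measurable_sections.

(** * Scalar classes under the lifting *)

Section scalar_classes.
Context d (Omega : measurableType d) (R : realType).
Variable mu : completeFiniteMeasure Omega R.
Implicit Types (f g : L0 mu) (h k : Omega -> R[i]) (r : R).

Lemma L0_eq f g h k : L0mem f h -> L0mem g k ->
  (\forall w \ae mu, h w = k w) -> f = g.
Proof.
move=> fh gk hk.
have /L0memP[mh _] := fh.
have [mh' gh] : L0mem g h.
  have /L0memP[_ gk'] := gk; apply/L0memP; split => //.
  by apply: filterS2 hk gk' => w -> .
have [mh'' fh'] := fh; rewrite gh fh'; congr L0class.
exact: Prop_irrelevance.
Qed.

Lemma L0mem_cst (c : R[i]) : L0mem (L0cst mu c) (fun=> c).
Proof. exact: L0mem_class. Qed.

Lemma cmeasurable_real (h : Omega -> R) : measurable_fun setT h ->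
  cmeasurable (fun w => (h w)%:C).
Proof. by move=> mh; split => //=; exact: measurable_cst. Qed.

Lemma measurable_invr (h : Omega -> R) : measurable_fun setT h ->
  (forall w, 0 <= h w) -> measurable_fun setT (fun w => (h w)^-1).
Proof.
move=> mh h0; rewrite (_ : (fun w => _) = (fun w => h w `^ -1)).
  exact: (measurableT_comp (measurable_powR _)).
by apply/funext => w; rewrite powR_inv1.
Qed.

Variable p : L0 mu -> Omega -> R[i].
Hypothesis p_lifting : is_lifting p.

(** [p] carries the essential supremum to the supremum, so an almost everywhere bound turns into one
    at every point. *)
Lemma lifting_le f h r : L0mem f h -> 0 <= r ->
  (\forall w \ae mu, `|h w| <= r%:C) -> forall w, `|p f w| <= r%:C.
Proof.
move=> fh r0 hr w; have fi := Linf_bound fh r0 hr.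
have pr : 0 <= `|p f w| := normr_ge0 _.
rewrite -(RRe_real (ger0_real pr)) lecR -lee_fin.
apply: (@le_trans _ _ (sup_norm (p f))).
  by apply: ereal_sup_ubound; exists w.
rewrite (lifting_norm p_lifting fi) /Linf_norm unlock.
(* In the other case the whole space is null and this norm is 0 by convention. *)
case: ifPn => _; last by rewrite lee_fin.
apply/ess_supP; have /L0memP[_ fh'] := fh.
apply: filterS2 fh' hr => v fv hv /=; rewrite lee_fin fv.
have hp : 0 <= `|h v| := normr_ge0 _.
move: hv; rewrite -{1}(RRe_real (ger0_real hp)) lecR => hv.
by rewrite ger0_norm// -lecR (RRe_real (ger0_real hp)).
Qed.

Lemma lifting_cst (c : R[i]) w : p (L0cst mu c) w = c.
Proof.
have i1 : Linf (L0cst mu 1).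
  apply: (Linf_bound (L0mem_cst 1) ler01); apply: aeW => v.
  by rewrite normr1.
have := liftingZ p_lifting c i1; rewrite (lifting1 p_lifting).
have -> : L0mul (L0cst mu c) (L0cst mu 1) = L0cst mu c.
  apply: L0_eq (L0mem_mul (L0mem_cst c) (L0mem_cst 1)) (L0mem_cst c) _.
  by apply: aeW => v; rewrite mulr1.
by move=> /(congr1 (@^~ w)) ->; rewrite /= mulr1.
Qed.

Lemma Linf_cst (c : R[i]) : Linf (L0cst mu c).
Proof.
have c0 : 0 <= `|c| := normr_ge0 _.
apply: (@Linf_bound _ _ _ _ _ _ (complex.Re `|c|) (L0mem_cst c)).
  by move: c0; rewrite lecE/= => /andP[].
by apply: aeW => w; rewrite RRe_real ?ger0_real.
Qed.

End scalar_classes.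

(** * Pointwise bounds through the vector-valued lifting *)

Section vector_lifting.
Context d (Omega : measurableType d) (R : realType).
Variable mu : completeFiniteMeasure Omega R.
Variable X : cstarBundle mu.
Variables (p : L0 mu -> Omega -> R[i]) (l : Lsec X -> forall w, X w).
Hypotheses (p_lifting : is_lifting p) (l_lifting : is_vector_lifting p l).
Implicit Types x y : Lsec X.

Lemma vlifting_val x : Linf_sec x -> \forall w \ae mu, l x w = Lval x w.
Proof.
move=> xi; apply: filterS (Lmem_val (vlifting_mem l_lifting xi)) => w.
by move=> -[].
Qed.

Lemma vlifting_le x (r : R) : 0 <= r ->
  (\forall w \ae mu, nr (Lval x w) <= r) -> forall w, nr (l x w) <= r.
Proof.
move=> r0 xr w; have xi : Linf_sec x by apply/Linf_secP; exists r.
have -> : nr (l x w) = complex.Re `|p (Lvnorm x) w|.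
  by rewrite -(vlifting_norm l_lifting xi) normr_id.
have pr : 0 <= `|p (Lvnorm x) w| := normr_ge0 _.
rewrite -lecR (RRe_real (ger0_real pr)).
apply: (lifting_le p_lifting (Lvnorm_val x) r0).
by apply: filterS xr => v; rewrite normr_id nr_le.
Qed.

Lemma vlifting_near w (a : X w) (r : R) : 0 < r ->
  exists2 x, Linf_sec x & nr (a - l x w) < r.
Proof.
move=> r0; have r0' : 0 < r%:C by rewrite ltcR.
have [] := vlifting_dense l_lifting (w := w) (O := ball a r%:C).
- by exists a; exact: ballxx.
- exact: ball_open.
move=> b [+ [x xi xb]]; rewrite -ball_normE/ball_/= nrE ltcR => ab.
by exists x; rewrite // xb.
Qed.

(* If [A] is the set where [r <= |x|], then [p 1_A] is idempotent and is the
   product of [p (1_A / |x|)], bounded by [1 / r], and [p |x|], which is less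
   than [r] at [w]; hence [p 1_A] vanishes at [w]. *)
Lemma vlifting_truncation x w (r : R) : Linf_sec x -> nr (l x w) < r ->
  exists f : L0 mu, [/\ Linf f, p f w = 1 &
    \forall v \ae mu, nr (Lval (Lscale f x) v) <= r].
Proof.
move=> xi xr; have r0 : 0 < r := le_lt_trans (nr_ge0 _) xr.
have [mx _] := measurable_section_norm (msectionP (repr x)).
pose A := [set v | r <= nr (Lval x v)].
have mA : measurable A.
  rewrite (_ : A = (fun v => nr (Lval x v)) @^-1` `[r, +oo[).
    by rewrite -[_ @^-1` _]setTI; exact: mx.
  by apply/seteqP; split=> v /=; rewrite in_itv/= andbT.
have mind (B : set Omega) : measurable B ->
    cmeasurable (fun v => (\1_B v : R)%:C).
  by move=> mB; apply/cmeasurable_real/measurable_indic.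
pose f := L0class mu (mind _ (measurableC mA)).
pose h := L0class mu (mind _ mA).
have fM : L0mem f (fun v => (\1_(~` A) v : R)%:C) by exact: L0mem_class.
have hM : L0mem h (fun v => (\1_A v : R)%:C) by exact: L0mem_class.
have ind1 (B : set Omega) v : `|(\1_B v : R)%:C| <= (1 : R)%:C.
  rewrite normC_real lecR indicE.
  by case: (v \in B); rewrite ?normr1 ?normr0 ?ler01.
have fi : Linf f by apply: (Linf_bound fM ler01); exact: aeW.
have hi : Linf h by apply: (Linf_bound hM ler01); exact: aeW.
have mg : cmeasurable (fun v => (\1_A v * (nr (Lval x v))^-1)%:C).
  apply/cmeasurable_real/measurable_funM; first exact: measurable_indic.
  by apply: measurable_invr => // v; exact: nr_ge0.
pose g := L0class mu mg.
have gM : L0mem g (fun v => (\1_A v * (nr (Lval x v))^-1)%:C).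
  exact: L0mem_class.
have rV0 : 0 <= r^-1 by rewrite invr_ge0 ltW.
have g1 v : `|(\1_A v * (nr (Lval x v))^-1)%:C| <= r^-1%:C.
  rewrite normC_real lecR indicE.
  have [|_] := boolP (v \in A); last by rewrite mul0r normr0.
  rewrite inE /A/= => rx; have x0 := lt_le_trans r0 rx.
  by rewrite mul1r ger0_norm ?invr_ge0 ?nr_ge0// lef_pV2.
have gi : Linf g by apply: (Linf_bound gM rV0); exact: aeW.
have hg : h = L0mul g (Lvnorm x).
  apply: L0_eq hM (L0mem_mul gM (Lvnorm_val x)) _; apply: aeW => v.
  rewrite nrE -rmorphM/= indicE.
  have [|_] := boolP (v \in A); last by rewrite !mul0r.
  rewrite inE /A/= => rx; have x0 := lt_le_trans r0 rx.
  by rewrite mul1r mulVf// gt_eqF.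
have hh : h = L0mul h h.
  apply: L0_eq hM (L0mem_mul hM hM) _; apply: aeW => v.
  by rewrite -rmorphM/= !indicE; case: (v \in A); rewrite ?mulr1 ?mulr0.
(* As [p] is additive and unital, [p f w = 1] will follow from [p h w = 0]. *)
have fh1 : L0add f h = L0cst mu 1.
  apply: L0_eq (L0mem_add fM hM) (L0mem_cst mu 1) _; apply: aeW => v.
  rewrite -rmorphD/= !indicE in_setC.
  by case: (v \in A); rewrite ?addr0 ?add0r.
have h_lt1 : `|p h w| < 1.
  rewrite hg (liftingM p_lifting gi xi) normrM.
  rewrite -(vlifting_norm l_lifting xi) normr_id nrE.
  apply: (@le_lt_trans _ _ (r^-1%:C * (nr (l x w))%:C)).
    by apply: ler_wpM2r; [rewrite ler0c nr_ge0
      |exact: (lifting_le p_lifting gM rV0 (aeW _ g1))].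
  rewrite -rmorphM/= -(rmorph1 (real_complex R)) ltcR.
  by rewrite ltr_pdivrMl// mulr1.
have h0 : p h w = 0.
  have : p h w * p h w = p h w.
    by rewrite {3}hh (liftingM p_lifting hi hi).
  move=> /eqP; rewrite -subr_eq0 -{3}[p h w]mulr1 -mulrBr mulf_eq0.
  rewrite subr_eq0 => /orP[/eqP //|/eqP h1].
  by move: h_lt1; rewrite h1 normr1 ltxx.
exists f; split=> //.
  have := liftingD p_lifting fi hi; rewrite fh1 (lifting1 p_lifting).
  by move=> /(congr1 (@^~ w)); rewrite /= h0 addr0.
apply: filterS (Lval_scale x fM) => v ->; rewrite nrZr indicE in_setC.
have [_|] := boolP (v \in A); first by rewrite normr0 mul0r ltW.
by rewrite notin_setE /A/= => /negP; rewrite -ltNge normr1 mul1r => /ltW.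
Qed.

End vector_lifting.

(** * Markov operators *)

Section markov.
Context d (Omega : measurableType d) (R : realType).
Variable mu : completeFiniteMeasure Omega R.
Variable X : cstarBundle mu.
Variables (p : L0 mu -> Omega -> R[i]) (l : Lsec X -> forall w, X w).
Hypotheses (p_lifting : is_lifting p) (l_lifting : is_vector_lifting p l).
Variable e : Lsec X.
Hypotheses (e_unit : Lunit e) (e_norm : Lvnorm e = L0cst mu 1).
Implicit Types (x y z : Lsec X) (r : R).

Let e_Linf : Linf_sec e.
Proof. by rewrite /Linf_sec e_norm; exact: Linf_cst. Qed.

(** Lifted values are dense, and [l e w] fixes them because [l] is multiplicative; for general [a]
    the error is at most [nr (l e w) + 1] times the distance to such a value. *)
Lemma cunit_vlifting w : cunit (l e w).
Proof.
have K0 : 0 < nr (l e w) + 1 by rewrite ltr_wpDl ?nr_ge0.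
move=> a; split; apply/eqP; rewrite -subr_eq0; apply/eqP/nr_near_zero => r r0;
  have [x xi ax] := vlifting_near l_lifting a (divr_gt0 r0 K0);
  have [ex xe] := e_unit x.
- have -> : cmul (l e w) a - a =
      cmul (l e w) (a - l x w) - (a - l x w).
    by rewrite cmulBr -(vliftingM l_lifting e_Linf xi) ex opprB addrA subrK.
  rewrite (le_trans (nrB _ _))// (le_trans (lerD (nrM _ _) (lexx _)))//.
  by rewrite -[X in _ + X]mul1r -mulrDl mulrC -ler_pdivlMr// ltW.
- have -> : cmul a (l e w) - a =
      cmul (a - l x w) (l e w) - (a - l x w).
    by rewrite cmulBl -(vliftingM l_lifting xi e_Linf) xe opprB addrA subrK.
  rewrite (le_trans (nrB _ _))// (le_trans (lerD (nrM _ _) (lexx _)))//.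
  by rewrite -[X in _ + X]mulr1 -mulrDr -ler_pdivlMr// ltW.
Qed.

(** Negation as an [L_0]-scaling, so that [LmarkovZ] moves it through [T]. *)
Let Lneg x := Lscale (L0cst mu (-1)) x.

Let Lval_neg x : \forall w \ae mu, Lval (Lneg x) w = - Lval x w.
Proof.
by apply: filterS (Lval_scale x (L0mem_cst mu (-1))) => w ->; rewrite scaleN1r.
Qed.

Let Lval_unit : \forall w \ae mu, l e w = Lval e w.
Proof. exact: (vlifting_val l_lifting e_Linf). Qed.

(** The root is [z = e - v], with [v] the measurable limit of the iteration at [y]; it is
    self-adjoint, so [z z] is [z] times its adjoint. *)
Lemma Lpositive_unitB y : Lstar y = y ->
  (\forall w \ae mu, nr (Lval y w) <= 1 / 2) -> Lpositive (Ladd e (Lneg y)).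
Proof.
move=> hy y2; have [v mv yv] := measurable_sqrt (msectionP (repr y)) y2.
pose z := Ladd e (Lneg (Lclass mv)).
have zE : \forall w \ae mu, Lval z w = l e w - sval v w.
  have vE := Lmem_val (Lmem_class mv).
  apply: filterS3 (filterI (Lval_add e (Lneg (Lclass mv))) vE)
    (Lval_neg (Lclass mv)) Lval_unit => w [-> vw] -> ->.
  by rewrite /sval vw.
have hyE : \forall w \ae mu, cstar (Lval y w) = Lval y w.
  by have := Lval_star y; rewrite hy; apply: filterS => w <-.
exists z; apply: Lsec_eq.
apply: filterS3 (filterI (Lval_add e (Lneg y)) (Lval_neg y))
  (filterI (filterI zE hyE) (filterI Lval_unit yv))
  (filterI (Lval_mul z (Lstar z)) (Lval_star z)) => w.
move=> [-> ->] [[ze hyw] [<- [_ yvw]]] [-> ->].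
have hv := sqrt_iter_lim_star yvw hyw.
rewrite ze cstarB (cunit_star (@cunit_vlifting w)) hv.
by rewrite (sqrt_iter_sqr (@cunit_vlifting w) yvw).
Qed.

Variable T : Lsec X -> Lsec X.
Hypothesis T_markov : is_Lmarkov e T.

Let TD := LmarkovD T_markov.
Let TZ := LmarkovZ T_markov.

(** [T] sends the positive elements [e - y] and [e + y] (written with a double negation) to
    [e - T y] and [e + T y], and [positive_bound] applies in almost every fibre. *)
Lemma markov_bound_herm y : Lstar y = y ->
  (\forall w \ae mu, nr (Lval y w) <= 1 / 2) ->
  \forall w \ae mu, nr (Lval (T y) w) <= 3.
Proof.
move=> hy y2.
have hny : Lstar (Lneg y) = Lneg y.
  apply: Lsec_eq.
  apply: filterS3 (Lval_star (Lneg y)) (Lval_star y) (Lval_neg y).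
  by move=> w -> ysE ->; rewrite cstarN -ysE hy.
have ny2 : \forall w \ae mu, nr (Lval (Lneg y) w) <= 1 / 2.
  by apply: filterS2 (Lval_neg y) y2 => w ->; rewrite nrN.
have [z zE] := Lmarkov_pos T_markov (Lpositive_unitB hy y2).
have [z' zE'] := Lmarkov_pos T_markov (Lpositive_unitB hny ny2).
rewrite TD (Lmarkov_unit T_markov) TZ -/(Lneg (T y)) in zE.
rewrite TD (Lmarkov_unit T_markov) !TZ -/(Lneg (T y)) -/(Lneg _) in zE'.
have V := Lval_add e (Lneg (T y)); have V' := Lval_add e (Lneg (Lneg (T y))).
apply: filterS3 (filterI (filterI V V') Lval_unit)
  (filterI (filterI (Lval_neg (T y)) (Lval_neg (Lneg (T y))))
     (filterI (Lval_mul z (Lstar z)) (Lval_mul z' (Lstar z'))))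
  (filterI (Lval_star z) (Lval_star z')) => w.
move=> [[+ +] eE] [[n1 n2] [m1 m2]] [s1 s2].
rewrite zE zE' => v1 v2.
apply: (positive_bound (@cunit_vlifting w)).
  by exists (Lval z w); rewrite eE -n1 -v1 m1 s1.
by exists (Lval z' w); rewrite eE -[Lval (T y) w]opprK -n1 -n2 -v2 m2 s2.
Qed.

(** With [x'] the adjoint of [x], [a = (x + x') / (4 r)] and [b = i (x - x') / (4 r)] are
    self-adjoint of norm at most [2 r / (4 r) = 1/2], and [x = 2 r (a - i b)]. As [T a] and [T b]
    are bounded by 3, the bound is [2 r (3 + 3) = 12 r]. *)
Lemma markov_bound x r : 0 < r -> (\forall w \ae mu, nr (Lval x w) <= r) ->
  \forall w \ae mu, nr (Lval (T x) w) <= 12 * r.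
Proof.
move=> r0 xr.
pose k : R := (4 * r)^-1.
have k0 : 0 < k by rewrite invr_gt0 mulr_gt0.
have kr : k * r = 1 / 4.
  by rewrite /k invfM -mulrA mulVf ?gt_eqF// mulr1 div1r.
pose a := Lscale (L0cst mu k%:C) (Ladd x (Lstar x)).
pose b := Lscale (L0cst mu (k%:C * 'i)) (Ladd x (Lneg (Lstar x))).
have aE : \forall w \ae mu,
    Lval a w = k%:C *: (Lval x w + cstar (Lval x w)).
  apply: filterS3 (Lval_scale (Ladd x (Lstar x)) (L0mem_cst mu k%:C))
    (Lval_add x (Lstar x))
    (Lval_star x) => w.
  by rewrite /a => -> -> ->.
have bE : \forall w \ae mu,
    Lval b w = k%:C *: ('i *: (Lval x w - cstar (Lval x w))).
  apply: filterS3 (Lval_scale (Ladd x (Lneg (Lstar x)))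
      (L0mem_cst mu (k%:C * 'i)))
    (Lval_add x (Lneg (Lstar x)))
    (filterI (Lval_star x) (Lval_neg (Lstar x))) => w.
  by rewrite /b scalerA => -> -> [<- ->].
have ha : Lstar a = a.
  apply: Lsec_eq; apply: filterS2 (Lval_star a) aE => w -> ->.
  by rewrite cstarZr cstarD cstarK addrC.
have hb : Lstar b = b.
  apply: Lsec_eq; apply: filterS2 (Lval_star b) bE => w -> ->.
  by rewrite cstarZr cstarZi cstarB cstarK -scalerN opprB.
have a2 : \forall w \ae mu, nr (Lval a w) <= 1 / 2.
  apply: filterS2 aE xr => w -> xr; rewrite nrZr gtr0_norm//.
  have := nrD (Lval x w) (cstar (Lval x w)); rewrite nr_star => h.
  by have := ler_wpM2l (ltW k0) (le_trans h (lerD xr xr)); lra.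
have b2 : \forall w \ae mu, nr (Lval b w) <= 1 / 2.
  apply: filterS2 bE xr => w -> xr; rewrite nrZr nrZi gtr0_norm//.
  have := nrB (Lval x w) (cstar (Lval x w)); rewrite nr_star => h.
  by have := ler_wpM2l (ltW k0) (le_trans h (lerD xr xr)); lra.
have xE : x = Ladd (Lscale (L0cst mu (r + r)%:C) a)
                   (Lneg (Lscale (L0cst mu ((r + r)%:C * 'i)) b)).
  apply: Lsec_eq.
  apply: filterS3 (filterI (Lval_add (Lscale (L0cst mu (r + r)%:C) a)
      (Lneg (Lscale (L0cst mu ((r + r)%:C * 'i)) b)))
      (Lval_scale a (L0mem_cst mu (r + r)%:C)))
    (filterI (Lval_neg (Lscale (L0cst mu ((r + r)%:C * 'i)) b))
      (Lval_scale b (L0mem_cst mu ((r + r)%:C * 'i))))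
    (filterI aE bE) => w [-> ->] [-> ->] [-> ->].
  have h1 : (r + r)%:C * k%:C = (2^-1 : R)%:C.
    by rewrite -rmorphM/=; congr (_%:C); lra.
  have -> : ((r + r)%:C * 'i) *:
      (k%:C *: ('i *: (Lval x w - cstar (Lval x w)))) =
      - ((2^-1 : R)%:C *: (Lval x w - cstar (Lval x w))).
    have h2 : (r + r)%:C * 'i * k%:C * 'i = - (2^-1 : R)%:C.
      by rewrite [_ * 'i * _]mulrAC h1 -mulrA -expr2 sqr_i mulrN1.
    by rewrite !scalerA h2 scaleNr.
  rewrite opprK scalerA h1 -scalerDr addrACA subrr addr0 -mulr2n.
  rewrite -[Lval x w *+ 2]scaler_nat scalerA -(rmorph_nat (real_complex R)).
  by rewrite -rmorphM/= mulVf// scale1r.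
have Tx : T x = Ladd (Lscale (L0cst mu (r + r)%:C) (T a))
                     (Lneg (Lscale (L0cst mu ((r + r)%:C * 'i)) (T b))).
  by rewrite xE TD !TZ.
apply: filterS3 (filterI (Lval_add (Lscale (L0cst mu (r + r)%:C) (T a))
    (Lneg (Lscale (L0cst mu ((r + r)%:C * 'i)) (T b))))
    (Lval_scale (T a) (L0mem_cst mu (r + r)%:C)))
  (filterI (Lval_neg (Lscale (L0cst mu ((r + r)%:C * 'i)) (T b)))
    (Lval_scale (T b) (L0mem_cst mu ((r + r)%:C * 'i))))
  (filterI (markov_bound_herm ha a2) (markov_bound_herm hb b2)).
move=> w [V1 V2] [V3 V4] [Ta Tb]; rewrite Tx V1 V2 V3 V4.
rewrite (le_trans (nrB _ _))// -scalerA !nrZr nrZi gtr0_norm ?addr_gt0//.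
by have := ler_wpM2l (ltW r0) Ta; have := ler_wpM2l (ltW r0) Tb; lra.
Qed.

Lemma Linf_markov x : Linf_sec x -> Linf_sec (T x).
Proof.
move=> /Linf_secP[r r0 xr].
have r1 : 0 < r + 1 by rewrite ltr_wpDl.
apply/Linf_secP; exists (12 * (r + 1)); first by rewrite mulr_ge0 ?ltW.
apply: markov_bound => //; apply: filterS xr => w /le_trans; apply.
by rewrite lerDl.
Qed.

(** For [r] above [nr (l x w)] the truncation [f x] is essentially bounded by [r], hence
    [T (f x) = f (T x)] by [12 r]; at [w] the factor [p f w = 1] disappears. Then [r] decreases to
    [nr (l x w)]. *)
Lemma vlifting_markov_bound x w : Linf_sec x ->
  nr (l (T x) w) <= 12 * nr (l x w).
Proof.
move=> xi; have Txi := Linf_markov xi.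
suff h r : nr (l x w) < r -> nr (l (T x) w) <= 12 * r.
  apply/ler_addgt0Pl => s s0.
  have -> : s + 12 * nr (l x w) = 12 * (nr (l x w) + s / 12) by lra.
  by apply: h; rewrite ltrDl divr_gt0.
move=> xr; have r0 : 0 < r := le_lt_trans (nr_ge0 _) xr.
have [f [fi f1 fx]] := vlifting_truncation p_lifting l_lifting xi xr.
have := markov_bound r0 fx; rewrite TZ => Tfx.
have r12 : 0 <= 12 * r by rewrite mulr_ge0// ltW.
have := vlifting_le p_lifting l_lifting r12 Tfx w.
by rewrite (vliftingZ l_lifting fi Txi) f1 scale1r.
Qed.

Lemma fiber_markov w : exists Tw : {linear X w -> X w},
  (forall x, Linf_sec x -> Tw (l x w) = l (T x) w) /\ is_cmarkov Tw.
Proof.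
have Linf_comb (k : R[i]) x y : Linf_sec x -> Linf_sec y ->
    Linf_sec (Ladd (Lscale (L0cst mu k) x) y) /\
    forall v, l (Ladd (Lscale (L0cst mu k) x) y) v = k *: l x v + l y v.
  move=> xi yi; have kxi : Linf_sec (Lscale (L0cst mu k) x).
    have /Linf_secP[r r0 xr] := xi; apply/Linf_secP.
    have k0 : 0 <= complex.Re `|k|.
      by have := normr_ge0 k; rewrite lecE/= => /andP[].
    exists (complex.Re `|k| * r); first exact: mulr_ge0.
    apply: filterS2 (Lval_scale x (L0mem_cst mu k)) xr => v -> xr.
    by rewrite nrZ ler_wpM2l.
  split=> [|v]; last first.
    rewrite (vliftingD l_lifting kxi yi).
    by rewrite (vliftingZ l_lifting (Linf_cst _ _) xi) (lifting_cst p_lifting).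
  have /Linf_secP[r r0 xr] := kxi; have /Linf_secP[s s0 ys] := yi.
  apply/Linf_secP; exists (r + s); first exact: addr_ge0.
  apply: filterS3 (Lval_add (Lscale (L0cst mu k) x) y) xr ys => v -> xr ys.
  by rewrite (le_trans (nrD _ _))// lerD.
(* A relation, as two [x] with equal lifted values at [w] might a priori have different images. *)
pose S a b := exists2 x, Linf_sec x & l x w = a /\ l (T x) w = b.
have [Tw [TwS Twb]] : exists Tw : {linear X w -> X w},
    (forall a b, S a b -> Tw a = b) /\ forall a, nr (Tw a) <= 12 * nr a.
  apply: linear_extension => //.
  - move=> k _ _ _ _ [x xi [<- <-]] [y yi [<- <-]].
    have [ci cE] := Linf_comb k x y xi yi.
    exists (Ladd (Lscale (L0cst mu k) x) y) => //; split; first exact: cE.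
    have [_ cE'] := Linf_comb k _ _ (Linf_markov xi) (Linf_markov yi).
    by rewrite TD TZ cE'.
  - move=> a r r0; have [x xi ax] := vlifting_near l_lifting a r0.
    by exists (l x w), (l (T x) w); split=> //; exists x.
  - by move=> _ _ [x xi [<- <-]]; exact: vlifting_markov_bound.
have TwE x : Linf_sec x -> Tw (l x w) = l (T x) w.
  by move=> xi; apply: TwS; exists x.
exists Tw; split=> //; split; last first.
  exists (l e w); first exact: cunit_vlifting.
  by rewrite TwE// (Lmarkov_unit T_markov).
(* Near [b] lies a lifted value [c = l y w], and [Tw] sends [c] times its adjoint to the lifted
   value of an element [T (y y')], with [y'] the adjoint of [y]; that value is positive, and the
   cone is closed. *)
move=> _ [b ->]; apply: (positive_closed (@cunit_vlifting w)) => r r0.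
pose K := 12 * (nr b + nr b + 1).
have b0 := nr_ge0 b.
have K0 : 0 < K by rewrite /K; lra.
(* The 1 gives [nr c <= nr b + 1], so the two products differ by at most [(2 nr b + 1) nr (b - c)];
   [K] includes the bound 12 of [Tw]. *)
have q0 : 0 < Num.min 1 (r / K) by rewrite lt_min ltr01 divr_gt0.
have [y yi] := vlifting_near l_lifting b q0.
rewrite lt_min => /andP[y1 yK].
have yyi : Linf_sec (Lmul y (Lstar y)).
  have /Linf_secP[s s0 ys] := yi; apply/Linf_secP.
  exists (s * s); first exact: mulr_ge0.
  apply: filterS3 (Lval_mul y (Lstar y)) (Lval_star y) ys => v -> -> ys.
  by rewrite nr_Mstar expr2 ler_pM ?nr_ge0.
have ysi : Linf_sec (Lstar y).
  have /Linf_secP[s s0 ys] := yi; apply/Linf_secP; exists s => //.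
  by apply: filterS2 (Lval_star y) ys => v ->; rewrite nr_star.
exists (l (T (Lmul y (Lstar y))) w).
  have [z zE] := Lmarkov_pos T_markov (ex_intro _ y erefl : Lpositive _).
  have zi : Linf_sec z.
    have /Linf_secP[s s0] := Linf_markov yyi; rewrite zE => zs.
    (* [nr z ^+ 2 <= s] gives [nr z <= s + 1], which avoids a square root. *)
    apply/Linf_secP; exists (s + 1); first exact: addr_ge0.
    apply: filterS3 (Lval_mul z (Lstar z)) (Lval_star z) zs => v -> ->.
    by rewrite nr_Mstar; have := nr_ge0 (Lval z v); nra.
  have zsi : Linf_sec (Lstar z).
    have /Linf_secP[s s0 zs] := zi; apply/Linf_secP; exists s => //.
    by apply: filterS2 (Lval_star z) zs => v ->; rewrite nr_star.
  exists (l z w); rewrite zE (vliftingM l_lifting zi zsi).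
  by rewrite (vlifting_star l_lifting zi).
rewrite -TwE// -raddfB (vliftingM l_lifting yi ysi).
rewrite (vlifting_star l_lifting yi) (le_trans (Twb _))//.
set c := l y w in y1 yK *.
have -> : cmul b (cstar b) - cmul c (cstar c) =
    cmul b (cstar (b - c)) + cmul (b - c) (cstar c).
  by rewrite cstarB cmulBr cmulBl addrA subrK.
have c1 : nr c <= nr b + 1.
  by rewrite -(subKr b c) (le_trans (nrB _ _))// lerD2l ltW.
have := nrD (cmul b (cstar (b - c))) (cmul (b - c) (cstar c)).
have := nrM b (cstar (b - c)); have := nrM (b - c) (cstar c).
rewrite !nr_star.
have := ler_wpM2l (nr_ge0 (b - c)) c1.
have : K * nr (b - c) <= r by rewrite mulrC -ler_pdivlMr// ltW.
rewrite /K; lra.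
Qed.

(** Scaling by [f = 1 / (1 + |x|)] makes [x] essentially bounded, where [TwE] applies; this scalar
    passes through [T] and [Tw], vanishes nowhere and so cancels. *)
Lemma markov_fiberwise (Tw : forall w, {linear X w -> X w}) x :
  (forall w x, Linf_sec x -> Tw w (l x w) = l (T x) w) ->
  \forall w \ae mu, Lval (T x) w = Tw w (Lval x w).
Proof.
move=> TwE; pose h w : R := 1 + nr (Lval x w).
have h1 w : 1 <= h w by rewrite lerDl nr_ge0.
have h0 w : 0 < h w by exact: lt_le_trans (h1 w).
have mg : cmeasurable (fun w => ((h w)^-1)%:C).
  apply/cmeasurable_real/measurable_invr => [|w]; last exact: ltW.
  apply: measurable_funD; first exact: measurable_cst.
  by have [] := measurable_section_norm (msectionP (repr x)).
pose f := L0class mu mg.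
have fM : L0mem f (fun w => ((h w)^-1)%:C) by exact: L0mem_class.
have fxi : Linf_sec (Lscale f x).
  apply/Linf_secP; exists 1; first exact: ler01.
  apply: filterS (Lval_scale x fM) => w ->.
  rewrite nrZr gtr0_norm ?invr_gt0// mulrC ler_pdivrMr// mul1r.
  by rewrite lerDr.
have := vlifting_val l_lifting (Linf_markov fxi); rewrite TZ => Tfx.
apply: filterS3 (filterI Tfx (vlifting_val l_lifting fxi))
  (Lval_scale x fM) (Lval_scale (T x) fM) => w [+ +] fx fTx.
rewrite fx fTx => e1 e2.
have := TwE w _ fxi; rewrite TZ e1 e2 linearZ => /= H.
have hV : ((h w)^-1)%:C != 0 :> R[i].
  by apply/eqP => /(@complexI R)/eqP; rewrite invr_eq0 gt_eqF.
exact/esym/(scalerI hV).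
Qed.

End markov.

(** * Assembling the fibre operators into a measurable bundle *)

Theorem theorem4p5 (R : realType) (d : measure_display)
    (Omega : measurableType d) (mu : completeFiniteMeasure Omega R)
    (X : cstarBundle mu)
    (p : L0 mu -> Omega -> R[i]) (p_lifting : is_lifting p)
    (l : Lsec X -> forall w : Omega, X w) (l_lifting : is_vector_lifting p l)
    (e : Lsec X) (e_unit : Lunit e) (e_norm : Lvnorm e = L0cst mu 1)
    (T : Lsec X -> Lsec X) (T_markov : is_Lmarkov e T) :
  exists Tw : forall w : Omega, {linear X w -> X w},
    measurable_markov_bundle Tw /\
    forall (x : Lsec X) (u v : psection X), Lmem x u -> Lmem (T x) v ->
      \forall w \ae mu, v w = omap (Tw w) (u w).
Proof.
have H := fiber_markov p_lifting l_lifting e_unit e_norm T_markov.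
(* The choice is made in each fibre separately; measurability in [w] comes afterwards, from
   [TxE]. *)
pose Tw w := projT1 (cid (H w)).
have TwP w := projT2 (cid (H w)).
have TwE w x : Linf_sec x -> Tw w (l x w) = l (T x) w.
  by have [h _] := TwP w; exact: h.
have TxE (x : Lsec X) (u v : psection X) : Lmem x u -> Lmem (T x) v ->
    \forall w \ae mu, v w = omap (Tw w) (u w).
  move=> xu Txv.
  have := markov_fiberwise l_lifting e_unit e_norm T_markov x TwE.
  by apply: filterS3 (Lmem_val xu) (Lmem_val Txv) => w -> -> ->.
exists Tw; split=> //; split; last by apply: aeW => w; have [] := TwP w.
(* The image section agrees almost everywhere with a representative of [T] at the class of [u], so
   the simple sections approximating the latter serve for it. *)
move=> u mu_u; have [s ss sv] := msectionP (repr (T (Lclass mu_u))).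
exists s => //.
have := TxE _ _ _ (Lmem_class mu_u) (Lmem_repr (T (Lclass mu_u))).
by apply: filterS2 sv => w [rw sw] E; split; rewrite /sval -E.
Qed.
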